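(* Let $m\ge1$, $n\ge1$, $c\ge1$ be integers with $c>2n-2$. Let $F$ be the free group on the totally ordered set $X=\{x_1<\dots<x_m\}$ and $G=F/\gamma_{n+1}(F)$, the free nilpotent group of class $n$ and rank $m$ (the $n$-th nilpotent product of $m$ copies of $\mathbb{Z}$). Let $Y$ be the set of all basic commutators on $X$ of weights $c+1,\dots,c+n$ and $Z=\{[b,a]: a,b\in Y,\ b>a\}$. Then $$\mathcal{N}_{c,1}M(G)=\frac{\gamma_2(\gamma_{c+1}(F))}{[\gamma_{c+n+1}(F),\gamma_{c+1}(F)]}$$ is a free abelian group with basis $\{z\,[\gamma_{c+n+1}(F),\gamma_{c+1}(F)] : z\in Z\}$ (distinct elements of $Z$ giving distinct basis elements).
   Context: $\gamma_k(F)$ is the $k$-th term of the lower central series, $\gamma_2(H)=[H,H]$. For a group $G$ with free presentation $G\cong F/R$, the polynilpotent multiplier of class row $(c,1)$ (Baer invariant with respect to the variety $\mathcal{N}_{c,1}$ of groups having a normal subgroup $N$ nilpotent... equivalently with verbal subgroup $\gamma_2(\gamma_{c+1}(F))$) is $\mathcal{N}_{c,1}M(G)=\dfrac{R\cap\gamma_2(\gamma_{c+1}(F))}{[R,{}_cF,\gamma_{c+1}(F)]}$, where $[R,{}_1F]=[R,F]$, $[R,{}_cF]=[[R,{}_{c-1}F],F]$ and $[R,{}_cF,\gamma_{c+1}(F)]=[[R,{}_cF],\gamma_{c+1}(F)]$; for $R=\gamma_{n+1}(F)$ this equals the displayed quotient. Basic commutators on a totally ordered set $X$ of free generators are defined inductively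 with their weights $wt$: the elements of $X$ are the basic commutators of weight 1, ordered as in $X$. Assuming basic commutators of weight $<k$ have been defined and ordered, a commutator $[b,a]$ is a basic commutator of weight $k$ if $b,a$ are basic commutators with $wt(a)+wt(b)=k$, $b>a$, and, if $b=[b_1,b_2]$, then $b_2\le a$. The ordering is then extended to weight $k$ so that all basic commutators of smaller weight precede those of weight $k$; $Y$ carries the inherited order. *)

(* Defs.v *)
From HB Require Import structures.
From mathcomp Require Import all_boot all_order all_algebra.
Set Implicit Arguments. Unset Strict Implicit. Unset Printing Implicit Defensive.

Definition letter (m : nat) := ('I_m * bool)%type. (* (i,false)=x_i, (i,true)=x_i^-1 *)
Definition flip m (l : letter m) : letter m := (l.1, ~~ l.2).

Definition push m (l : letter m) (w : seq (letter m)) : seq (letter m) :=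
  if w is l' :: w' then (if l' == flip l then w' else l :: w) else [:: l].
Definition reduce m (w : seq (letter m)) := foldr (@push m) [::] w.
Definition reducedb m (w : seq (letter m)) := sorted (fun a b => b != flip a) w.

Lemma push_red m (l : letter m) w : reducedb w -> reducedb (push l w).
Proof.
case: w => [|l' w'] //= Hw; case: eqP => [_|/eqP H]; first exact: path_sorted Hw.
by rewrite /= H.
Qed.

Lemma reduce_red m (w : seq (letter m)) : reducedb (reduce w).
Proof. by elim: w => //= l w IH; apply: push_red. Qed.

Definition F (m : nat) := {w : seq (letter m) | reducedb w}.
Definition mkF m (w : seq (letter m)) : F m := exist _ (reduce w) (reduce_red w).
Definition fone m : F m := mkF [::].
Definition fmul m (x y : F m) : F m := mkF (sval x ++ sval y).
Definition finv m (x : F m) : F m := mkF (rev (map (@flip m) (sval x))).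
Definition gen_x m (i : 'I_m) : F m := mkF [:: (i, false)].
Definition comm m (a b : F m) : F m := fmul (fmul (fmul (finv a) (finv b)) a) b.
Definition zpow m (x : F m) (e : int) : F m :=
  match e with
  | Posz k => iter k (fmul x) (fone m)
  | Negz k => finv (iter k.+1 (fmul x) (fone m))
  end.

Inductive gen m (S : F m -> Prop) : F m -> Prop :=
| gen_one : gen S (fone m)
| gen_in x : S x -> gen S x
| gen_mul x y : gen S x -> gen S y -> gen S (fmul x y)
| gen_inv x : gen S x -> gen S (finv x).

Definition fullF m : F m -> Prop := fun _ => True.
Definition commsub m (H K : F m -> Prop) : F m -> Prop :=
  gen (fun g => exists h k, H h /\ K k /\ g = comm h k).

Fixpoint gamma (m : nat) (k : nat) {struct k} : F m -> Prop :=
  match k with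
  | 0 => @fullF m
  | k'.+1 => match k' with 0 => @fullF m | _ => commsub (gamma k') (@fullF m) end
  end.

Arguments gamma : clear implicits.

Fixpoint rcomm m (R : F m -> Prop) (c : nat) : F m -> Prop :=
  match c with 0 => R | c'.+1 => commsub (rcomm R c') (@fullF m) end.

(* polynilpotent multiplier N_{c,1}M(G) for G = F/R:
   numerator R ∩ γ2(γ_{c+1}F), denominator [R, _cF, γ_{c+1}F] *)
Definition NM_num m (R : F m -> Prop) (c : nat) : F m -> Prop :=
  fun g => R g /\ commsub (gamma m c.+1) (gamma m c.+1) g.
Definition NM_den m (R : F m -> Prop) (c : nat) : F m -> Prop :=
  commsub (rcomm R c) (gamma m c.+1).

Inductive tree (m : nat) : Type :=
| Leaf of 'I_m
| Node of tree m & tree m.   (* Node b a stands for [b,a] *)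
Arguments Leaf {m}. Arguments Node {m}.

Fixpoint enc m (t : tree m) : GenTree.tree 'I_m :=
  match t with
  | Leaf i => GenTree.Leaf i
  | Node b a => GenTree.Node 0 [:: enc b; enc a]
  end.
Fixpoint dec m (g : GenTree.tree 'I_m) : option (tree m) :=
  match g with
  | GenTree.Leaf i => Some (Leaf i)
  | GenTree.Node _ [:: gb; ga] =>
      match dec gb, dec ga with Some b, Some a => Some (Node b a) | _, _ => None end
  | _ => None
  end.
Lemma encK m : pcancel (@enc m) (@dec m).
Proof. by elim=> [i|b IHb a IHa] //=; rewrite IHb IHa. Qed.
HB.instance Definition _ m := Countable.copy (tree m) (pcan_type (@encK m)).

Fixpoint wt m (t : tree m) : nat :=
  match t with Leaf _ => 1 | Node b a => wt b + wt a end.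

Fixpoint eval m (t : tree m) : F m :=
  match t with Leaf i => gen_x i | Node b a => comm (eval b) (eval a) end.

(* An admissible ordering: a strict total order on formal commutators which on
   weight 1 is the order of X and in which smaller weight precedes larger
   weight. Restricting it to basic commutators gives exactly the orderings
   allowed in the definition of basic commutators (ties inside one weight are
   arbitrary). *)
Definition admissible m (lt : tree m -> tree m -> Prop) : Prop :=
  [/\ (forall a, ~ lt a a),
      (forall a b d, lt a b -> lt b d -> lt a d),
      (forall a b, a <> b -> lt a b \/ lt b a),
      (forall i j : 'I_m, lt (Leaf i) (Leaf j) <-> (i < j)%N) &
      (forall a b, (wt a < wt b)%N -> lt a b)].

Fixpoint basic m (lt : tree m -> tree m -> Prop) (t : tree m) : Prop :=
  match t with
  | Leaf _ => True
  | Node b a =>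
      [/\ basic lt b, basic lt a, lt a b &
          match b with Leaf _ => True | Node b1 b2 => b2 = a \/ lt b2 a end]
  end.

Definition Yset m lt (c n : nat) (t : tree m) : Prop :=
  basic lt t /\ (c.+1 <= wt t <= c + n)%N.
Definition Zset m lt (c n : nat) (t : tree m) : Prop :=
  exists b a, t = Node b a /\ Yset lt c n b /\ Yset lt c n a /\ lt a b.

Definition prodz m (e : tree m -> int) (s : seq (tree m)) : F m :=
  foldr (fun z acc => fmul (zpow (eval z) (e z)) acc) (fone m) s.

Definition free_abelian_basis m (A N : F m -> Prop) (Z : tree m -> Prop) : Prop :=
  [/\ (forall g, N g -> A g),
      (forall g h, A g -> A h -> N (comm g h)),
      (forall z, Z z -> A (eval z)),
      (forall g, A g -> exists (s : seq (tree m)) (e : tree m -> int),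
           [/\ (forall z, z \in s -> Z z), uniq s & N (fmul g (finv (prodz e s)))]) &
      (forall (s : seq (tree m)) (e : tree m -> int),
           (forall z, z \in s -> Z z) -> uniq s -> N (prodz e s) ->
           forall z, z \in s -> e z = 0)].

(* Main.v *)
(** Put [H := gamma_(c+1)] and [K := gamma_(c+n+1)].  Since [n <= c + 1] we have
    [[H, H] <= K <= H], so the commutator map induces a surjection of the
    exterior square of [H / K] onto [[H, H] / [K, H]]; as [H / K] is spanned by
    [Y], the quotient is spanned by [Z].

    For independence, let [S] be the set of basic commutators [[b1, b2]] of
    weight [> c] with [wt b2 <= c].  Lazard elimination, applied to the basic
    commutators of weight [<= c] in increasing order, shows that the Lie
    brackets of the elements of [S] are free in the free associative algebra;
    hence so are the deviations [magnus (eval s) - 1], whose leading terms are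
    these brackets.  The subalgebra they generate contains [magnus H], so the
    coefficients there of the words [b], [a] and [b a] ([a], [b] in [Y]) are
    functions [f_b], [f_a], [q] on [H] such that [f_b], [f_a] are additive and
    vanish on [K], and [q (g h) = q g + q h + f_b g * f_a h].  Thus [q] is
    additive on [[H, H]], vanishes on [[K, H]], and separates [[b, a]] from the
    other elements of [Z]. *)

From HB Require Import structures.
From mathcomp Require Import all_boot all_order all_algebra.
From mathcomp Require Import boolp ring zify.
Require Import Defs.
Set Implicit Arguments. Unset Strict Implicit. Unset Printing Implicit Defensive.
Import GRing.Theory.

(** * The free group on reduced words *)

Section FreeGroup.
Variable m : nat.
Implicit Types (l : letter m) (v w : seq (letter m)).

Lemma flipK : involutive (@flip m).
Proof. by case=> i b; rewrite /flip /= negbK. Qed.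

Lemma reduce_id w : reducedb w -> reduce w = w.
Proof.
elim: w => //= l w IH Hw; rewrite IH; last exact: path_sorted Hw.
by case: w Hw {IH} => [|l' w] //= /andP[/negPf-> _].
Qed.

Lemma push_flip l w : reducedb w -> push (flip l) (push l w) = w.
Proof.
case: w => [|l' w] /= Hw; first by rewrite flipK eqxx.
case: (l' =P flip l) => [E|_]; last by rewrite /= flipK eqxx.
by subst l'; case: w Hw => //= l' w /andP[/negPf-> _].
Qed.

(** The letters act on reduced words by [push], and by [push_flip] a letter and its flip act as
    mutually inverse maps, so cancelling such pairs inside [w] leaves its action unchanged.
    Associativity and the inverse law rest on this. *)
Lemma foldr_push_reduce w v : reducedb v ->
  foldr (@push m) v (reduce w) = foldr (@push m) v w.
Proof.
move=> Hv.
have red u : reducedb (foldr (@push m) v u) by elim: u => //= l u; apply: push_red.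
have step l u : foldr (@push m) v (push l u) = push l (foldr (@push m) v u).
  case: u => //= l' u; case: (l' =P flip l) => // -> /=.
  by rewrite -{1}(flipK l) push_flip.
by elim: w => //= l w IH; rewrite step IH.
Qed.

Lemma reduce_cat w v : reduce (w ++ v) = foldr (@push m) (reduce v) w.
Proof. by rewrite /reduce foldr_cat. Qed.

HB.instance Definition _ := Choice.on (F m).

Lemma fmulA : associative (@fmul m).
Proof.
move=> x y z; apply: val_inj => /=.
rewrite (reduce_cat (sval x)) (reduce_id (reduce_red _)) -reduce_cat catA.
by rewrite (reduce_cat (reduce _)) foldr_push_reduce ?reduce_red // -reduce_cat.
Qed.

Lemma fmul1 : left_id (fone m) (@fmul m).
Proof. by move=> [w Hw]; apply: val_inj; rewrite /= reduce_id. Qed.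

Lemma fmulr1 : right_id (fone m) (@fmul m).
Proof. by move=> [w Hw]; apply: val_inj; rewrite /= cats0 reduce_id. Qed.

Lemma fmulV : left_inverse (fone m) (@finv m) (@fmul m).
Proof.
move=> [w Hw]; apply: val_inj; rewrite /= reduce_cat.
rewrite foldr_push_reduce ?reduce_red // (reduce_id Hw).
elim: w Hw => //= l w IH Hw; rewrite rev_cons -cats1 foldr_cat /=.
rewrite flipK eqxx; apply: IH; exact: path_sorted Hw.
Qed.

Lemma fmulVr : right_inverse (fone m) (@finv m) (@fmul m).
Proof.
move=> x; rewrite -[LHS]fmul1 -{1}(fmulV (finv x)) -!fmulA.
by rewrite (fmulA _ x) fmulV fmul1 fmulV.
Qed.

End FreeGroup.

HB.instance Definition _ m := isGroup.Build (F m) (@fmulA m) (@fmul1 m) (@fmulr1 m) (@fmulV m) (@fmulVr m).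

(** * Commutator calculus and the lower central series *)

Section CommutatorIdentities.
Variable G : groupType.
Local Open Scope group_scope.
Implicit Types x y z : G.

Lemma commMg x y z : [~ x * y, z] = [~ x, z] * [~ [~ x, z], y] * [~ y, z].
Proof. by rewrite !(commgEl, conjgE, invgM, invgK, =^~ mulgA, mulKg, mulVKg, mulVg, mulgV, mulg1). Qed.

Lemma commgM x y z : [~ x, y * z] = [~ x, z] * [~ x, y] * [~ [~ x, y], z].
Proof. by rewrite !(commgEl, conjgE, invgM, invgK, =^~ mulgA, mulKg, mulVKg, mulVg, mulgV, mulg1). Qed.

Lemma commVg x y : [~ x^-1, y] = ([~ x, y] * [~ [~ x, y], x^-1])^-1.
Proof. by rewrite !(commgEl, conjgE, invgM, invgK, =^~ mulgA, mulKg, mulVKg, mulVg, mulgV, mulg1). Qed.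

Lemma commgV x y : [~ x, y^-1] = ([~ x, y] * [~ [~ x, y], y^-1])^-1.
Proof. by rewrite !(commgEl, conjgE, invgM, invgK, =^~ mulgA, mulKg, mulVKg, mulVg, mulgV, mulg1). Qed.

Lemma Hall_Witt x y z :
  [~ [~ x, y^-1], z] ^ y * [~ [~ y, z^-1], x] ^ z * [~ [~ z, x^-1], y] ^ x = 1.
Proof. by rewrite !(commgEl, conjgE, invgM, invgK, =^~ mulgA, mulKg, mulVKg, mulVg, mulgV, mulg1). Qed.

End CommutatorIdentities.

Arguments gamma : simpl never.

Section Subgroups.
Variable m : nat.
Local Open Scope group_scope.
Implicit Types (x y z g h : F m) (P Q S W : F m -> Prop).

Lemma commE x y : comm x y = [~ x, y].
Proof. by rewrite /comm -[LHS]/(x^-1 * y^-1 * x * y) commgEl conjgE !mulgA. Qed.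

Record subgroup W : Prop := Subgroup {
  sub1 : W 1;
  subM : forall x y, W x -> W y -> W (x * y);
  subV : forall x, W x -> W x^-1 }.

Definition normal W := forall x g, W x -> W (x ^ g).

Lemma gen_sub S : subgroup (gen S).
Proof. by split; [apply: gen_one | apply: gen_mul | apply: gen_inv]. Qed.

Lemma gen_min S W : subgroup W -> (forall x, S x -> W x) -> forall x, gen S x -> W x.
Proof.
move=> sW SW x; elim=> {x} [|||] //; first exact: sub1 sW.
- by move=> x y _ Wx _ Wy; apply: (subM sW).
- by move=> x _ Wx; apply: (subV sW).
Qed.

Lemma gen_mono S1 S2 : (forall x, S1 x -> S2 x) -> forall x, gen S1 x -> gen S2 x.
Proof. by move=> H; apply: gen_min (gen_sub _) _ => x /H; apply: gen_in. Qed.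

Lemma subVE W x : subgroup W -> W x^-1 <-> W x.
Proof. by move=> sW; split=> /(subV sW); rewrite ?invgK. Qed.

Lemma subMr W x y : subgroup W -> W y -> W (x * y) <-> W x.
Proof.
move=> sW Wy; split=> [Wxy|Wx]; last exact: (subM sW).
by rewrite -(mulgK y x); apply: (subM sW) => //; apply: (subV sW).
Qed.

Lemma subJ W x g : subgroup W -> W [~ x, g] -> W (x ^ g) <-> W x.
Proof.
by move=> sW Wxg; rewrite -{1}(mulVKg x (x ^ g)) -commgEl; apply: subMr.
Qed.

Lemma subR W x y : subgroup W -> W [~ x, y] <-> W [~ y, x].
Proof. by move=> sW; rewrite -invgR; apply: subVE. Qed.

Lemma full_sub : subgroup (@fullF m). Proof. by []. Qed.
Lemma full_normal : normal (@fullF m). Proof. by []. Qed.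

Lemma comm_in P Q x y : P x -> Q y -> commsub P Q [~ x, y].
Proof. by move=> Px Qy; apply: gen_in; exists x, y; rewrite commE. Qed.

Lemma commsub_min P Q W : subgroup W -> (forall x y, P x -> Q y -> W [~ x, y]) ->
  forall x, commsub P Q x -> W x.
Proof. by move=> sW H; apply: gen_min => // _ [x [y [Px [Qy ->]]]]; rewrite commE; apply: H. Qed.

Lemma commsub_mono P Q P' Q' : (forall x, P x -> P' x) -> (forall x, Q x -> Q' x) ->
  forall x, commsub P Q x -> commsub P' Q' x.
Proof. by move=> HP HQ; apply: commsub_min (gen_sub _) _ => x y /HP Px /HQ Qy; apply: comm_in. Qed.

Lemma commsub_normal P Q : normal P -> normal Q -> normal (commsub P Q).
Proof.
move=> nP nQ x g; elim=> {x} [|_ [x [y [Px [Qy ->]]]]|x y _ IHx _ IHy|x _ IHx].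
- by rewrite conj1g; apply: gen_one.
- by rewrite commE conjRg; apply: comm_in; [apply: nP | apply: nQ].
- by rewrite -[fmul x y]/(x * y) conjMg; apply: gen_mul.
- by rewrite -[finv x]/(x^-1) conjVg; apply: gen_inv.
Qed.

(* Modulo [W] the commutator is bilinear on [P * Q], so it suffices to check
   membership in [W] on generators. *)
Lemma comm_gen P Q W X Y : subgroup P -> subgroup Q -> subgroup W ->
  (forall x, X x -> P x) -> (forall y, Y y -> Q y) ->
  (forall x x' y, P x -> P x' -> Q y -> W [~ [~ x, y], x']) ->
  (forall x y y', P x -> Q y -> Q y' -> W [~ [~ x, y], y']) ->
  (forall x y, X x -> Y y -> W [~ x, y]) ->
  forall x y, gen X x -> gen Y y -> W [~ x, y].
Proof.
move=> sP sQ sW XP YQ cP cQ H x y Gx Gy.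
have Py := gen_min sQ YQ.
have Px := gen_min sP XP.
elim: Gx => {x} [|x Xx|x x' Gx IH Gx' IH'|x Gx IH].
- by rewrite comm1g; apply: sub1.
- elim: Gy => {y} [|y|y y' Gy IH Gy' IH'|y Gy IH].
  + by rewrite commg1; apply: sub1.
  + exact: H.
  + rewrite -[fmul y y']/(y * y') commgM; apply: (subM sW); first exact: (subM sW).
    by apply: cQ; [apply: XP | apply: Py | apply: Py].
  + rewrite -[finv y]/(y^-1) commgV; apply: (subV sW); apply: (subM sW) => //.
    by apply: cQ; [apply: XP | apply: Py | apply: (subV sQ); apply: Py].
- rewrite -[fmul x x']/(x * x') commMg; do 2?apply: (subM sW) => //.
  by apply: cP; [apply: Px | apply: Px | apply: Py].
- rewrite -[finv x]/(x^-1) commVg; apply: (subV sW); apply: (subM sW) => //.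
  by apply: cP; [apply: Px | apply: (subV sP); apply: Px | apply: Py].
Qed.

Lemma gammaS k : gamma m k.+2 = commsub (gamma m k.+1) (@fullF m).
Proof. by []. Qed.

Lemma gamma_sub k : subgroup (gamma m k).
Proof. by case: k => [|[|k]]; [exact: full_sub | exact: full_sub | exact: gen_sub]. Qed.

Lemma gamma_normal k : normal (gamma m k).
Proof.
elim: k => [|[|k] IH]; [exact: full_normal | exact: full_normal |].
rewrite gammaS; exact: commsub_normal.
Qed.

Lemma gammaW k x : gamma m k.+1 x -> gamma m k x.
Proof.
case: k => // k; rewrite gammaS; apply: commsub_min; first exact: gamma_sub.
move=> {}x y Gx _; rewrite commgEl; apply: (subM (gamma_sub _)).
  exact: subV (gamma_sub _) _ Gx.
exact: gamma_normal.
Qed.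

Lemma gamma_le i j x : i <= j -> gamma m j x -> gamma m i x.
Proof.
move=> /subnK <-; elim: (j - i)%N => // k IH; rewrite addSn => /gammaW; exact: IH.
Qed.

(** Induction on [j] as in the three subgroups lemma: for a generator [[y, z]] of the second
    argument, the Hall-Witt identity reduces the triple commutator with [x] to [[[z, x], y]] and
    [[[x, y], z]], up to inverses and conjugation. *)
Lemma gammaR i j x y : gamma m i x -> gamma m j y -> gamma m (i + j) [~ x, y].
Proof.
wlog suff: i j x y / gamma m i.+1 x -> gamma m j.+1 y -> gamma m (i + j).+2 [~ x, y].
  (* Indices 0 and 1 both denote the whole group, so a zero index only asks for normality. *)
  move=> H; case: i => [|i] Gx.
    case: j => // j Gy; apply/(subR _ _ (gamma_sub _)).
    by rewrite commgEl; apply: (subM (gamma_sub _)); [apply: (subV (gamma_sub _)) | apply: gamma_normal].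
  case: j => [|j] Gy; last by rewrite addSn addnS; apply: H.
  by rewrite addn0 commgEl; apply: (subM (gamma_sub _)); [apply: (subV (gamma_sub _)) | apply: gamma_normal].
elim: j i x y => [|j IH] i x y Gx; first by rewrite addn0 => _; apply: comm_in.
rewrite gammaS; set V := gamma m (i + j.+1).+2.
have sV : subgroup V := gamma_sub _.
have nV : normal V := @gamma_normal _.
rewrite -/gamma; suff: forall y, commsub (gamma m j.+1) (@fullF m) y ->
  forall x, gamma m i.+1 x -> V [~ y, x] by move=> H /H - /(_ x Gx) /(subR _ _ sV).
move=> {Gx}{}y Gy; elim: Gy => {x y} [|_ [y [z [Gy [_ ->]]]]|y y' _ Gy _ Gy'|y _ Gy] x Gx.
- by rewrite comm1g; apply: sub1.
- rewrite commE.
  have := Hall_Witt y z^-1 x; rewrite invgK.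
  suff Vq : V [~ [~ z^-1, x^-1], y] /\ V [~ [~ x, y^-1], z^-1].
    case: Vq => /(nV _ x) Vq /(nV _ y) Vr E.
    rewrite -(conjgK z^-1 [~ _, x]); apply: (nV); move: (sub1 sV); rewrite -E.
    by move=> /(subMr _ sV Vr) /(subMr _ sV Vq).
  split.
    rewrite /V addnS -addSn; apply: IH => //.
    apply/(subR _ _ (gamma_sub _)); rewrite gammaS; apply: comm_in => //.
    exact: (subV (gamma_sub _)).
  rewrite /V addnS gammaS; apply: comm_in => //; apply: IH => //.
  exact: (subV (gamma_sub _)).
- rewrite -[fmul y y']/(y * y') commMg; apply: (subM sV); last exact: Gy'.
  apply: (subM sV); first exact: Gy.
  by rewrite commgEl; apply: (subM sV); [apply: (subV sV)|apply: nV]; apply: Gy.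
- rewrite -[finv y]/(y^-1) commVg; apply: (subV sV); apply: (subM sV); first exact: Gy.
  by rewrite commgEl; apply: (subM sV); [apply: (subV sV)|apply: nV]; apply: Gy.
Qed.

End Subgroups.

(** * Basic commutators span the lower central factors *)

Section Jacobi.
Variable m : nat.
Local Open Scope group_scope.
Implicit Types (x y z g h : F m) (P Q S W X Y : F m -> Prop).

(** As [i] and [j] are positive, the triple commutators that obstruct bilinearity lie in
    [gamma m (i + j).+1], hence in [W]. *)
Lemma comm_gen_gamma i j W X Y : 0 < i -> 0 < j -> subgroup W ->
  (forall x, gamma m (i + j).+1 x -> W x) ->
  (forall x, X x -> gamma m i x) -> (forall y, Y y -> gamma m j y) ->
  (forall x y, X x -> Y y -> W [~ x, y]) ->
  forall x y, gen X x -> gen Y y -> W [~ x, y].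
Proof.
move=> i0 j0 sW gW XP YQ; apply: (comm_gen (gamma_sub m i) (gamma_sub m j)) => //.
- move=> x x' y Gx Gx' Gy; apply/gW/gamma_le/(gammaR (gammaR Gx Gy) Gx').
  by rewrite -addn1 leq_add2l.
- move=> x y y' Gx Gy Gy'; apply/gW/gamma_le/(gammaR (gammaR Gx Gy) Gy').
  by rewrite -addn1 leq_add2l.
Qed.

(** [[x, y^-1]] is [[x, y]^-1] up to a factor of weight above [i + j], so modulo weight
    [i + j + k + 1] the triple commutator is merely inverted. *)
Lemma comm3V i j k W x y z : 0 < i -> 0 < j -> 0 < k -> subgroup W ->
  (forall g, gamma m (i + j + k).+1 g -> W g) ->
  gamma m i x -> gamma m j y -> gamma m k z ->
  W [~ [~ x, y], z] -> W [~ [~ x, y^-1], z].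
Proof.
move=> i0 j0 k0 sW gW Gx Gy Gz H.
have Gxy := gammaR Gx Gy.
apply: (@comm_gen_gamma (i + j) k W (fun g => g = [~ x, y] \/ gamma m (i + j).+1 g) (eq z)) => //.
- by rewrite addn_gt0 i0.
- by move=> g [->|] //; apply: gammaW.
- by move=> g <-.
- by move=> g h [->|Gg] <- //; apply/gW; rewrite -addSn; apply: gammaR.
- rewrite commgV; apply: gen_inv; apply: gen_mul; first by apply: gen_in; left.
  apply: gen_in; right; apply/gamma_le/(gammaR Gxy (subV (gamma_sub _ _) Gy)).
  by rewrite -addn1 leq_add2l.
- exact: gen_in.
Qed.

(** Modulo weight [i + j + k + 1] the conjugations in the Hall-Witt identity disappear and, by
    [comm3V], so do the inverses. *)
Lemma Jacobi i j k W x y z : 0 < i -> 0 < j -> 0 < k -> subgroup W ->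
  (forall g, gamma m (i + j + k).+1 g -> W g) ->
  gamma m i x -> gamma m j y -> gamma m k z ->
  W [~ [~ y, z], x] -> W [~ [~ z, x], y] -> W [~ [~ x, y], z].
Proof.
move=> i0 j0 k0 sW gW Gx Gy Gz H1 H2.
have GV l g : gamma m l g -> gamma m l g^-1 by exact: subV (gamma_sub _ _) _.
have WJ a b c u v w h : (a + b + c = i + j + k)%N -> 
    gamma m a u -> gamma m b v -> gamma m c w -> 
    W ([~ [~ u, v], w] ^ h) <-> W [~ [~ u, v], w].
  move=> E Gu Gv Gw; apply: subJ => //; apply: gW; rewrite -E -addn1.
  by apply: gammaR => //; do 2?apply: gammaR.
have E1 : (j + k + i = i + j + k)%N by rewrite addnC addnA.
have E2 : (k + i + j = i + j + k)%N by rewrite -addnA addnC.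
have Wq : W ([~ [~ y, z^-1], x] ^ z).
  by apply/(WJ j k i); auto; apply: (comm3V j0 k0 i0) => //; rewrite E1.
have Wr : W ([~ [~ z, x^-1], y] ^ x).
  by apply/(WJ k i j); auto; apply: (comm3V k0 i0 j0) => //; rewrite E2.
rewrite -[y]invgK; apply: (comm3V i0 j0 k0) => //; first exact: GV.
apply/(WJ i j k _ _ _ y); auto.
apply: (proj1 (subMr _ sW Wq)); apply: (proj1 (subMr _ sW Wr)).
by rewrite Hall_Witt; apply: sub1.
Qed.

End Jacobi.

Section Span.
Variables (m : nat) (lt : tree m -> tree m -> Prop).
Hypothesis Hlt : admissible lt.
Local Open Scope group_scope.
Implicit Types (s t u v a b : tree m).

Lemma wt_gt0 t : 0 < wt t.
Proof. by elim: t => //= b IH a _; rewrite addn_gt0 IH. Qed.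

(** The trees of height at most [k]: a finite list containing every tree of weight at most [k], and
    possibly heavier ones. *)
Fixpoint trees k : seq (tree m) :=
  if k is k'.+1 then map Leaf (enum 'I_m) ++ [seq Node b a | b <- trees k', a <- trees k']
  else [::].

Lemma mem_trees k t : wt t <= k -> t \in trees k.
Proof.
elim: k t => [|k IH] t; first by rewrite leqNgt wt_gt0.
case: t => [i|b a] /= H; rewrite mem_cat; first by rewrite map_f // mem_enum.
apply/orP; right; apply/allpairs_f; apply: IH.
    by have := wt_gt0 a; rewrite -(leq_add2l (wt b)) addn1 => /leq_trans/(_ H).
  by have := wt_gt0 b; rewrite -(leq_add2r (wt a)) add1n => /leq_trans/(_ H).
Qed.

Lemma lt_irr a : ~ lt a a. Proof. by case: Hlt. Qed.
Lemma lt_trans b a d : lt a b -> lt b d -> lt a d. Proof. by case: Hlt => _ + _ _ _; exact. Qed.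
Lemma lt_wt a b : wt a < wt b -> lt a b. Proof. by case: Hlt => _ _ _ _; exact. Qed.
Lemma lt_total a b : [\/ a = b, lt a b | lt b a].
Proof.
case: (pselect (a = b)) => [->|ab]; first exact: Or31.
by case: Hlt => _ _ /(_ a b ab) [H|H] _ _; [apply: Or32 | apply: Or33].
Qed.
Lemma wt_lt a b : lt a b -> wt a <= wt b.
Proof. by move=> H; rewrite leqNgt; apply/negP => /lt_wt/(lt_trans H)/lt_irr. Qed.

Lemma gamma_eval t : gamma m (wt t) (eval t).
Proof. by elim: t => //= b Gb a Ga; rewrite commE; apply: gammaR. Qed.

Definition basic_or_gamma k (g : F m) :=
  (exists t, [/\ basic lt t, wt t = k & g = eval t]) \/ gamma m k.+1 g.

Lemma basic_or_gamma_sub k g : gen (basic_or_gamma k) g -> gamma m k g.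
Proof.
apply: gen_min => {g}[|g [[t [_ <- ->]]|]]; first exact: gamma_sub.
  exact: gamma_eval.
exact: gammaW.
Qed.

(** Hall's rewriting by a double induction: on the weight [n], and for fixed [n] downwards on the
    smaller entry [a]. If [b = [b1, b2]] with [a < b2], the Jacobi identity replaces [[b, a]] by
    [[[b2, a], b1]] and [[[a, b1], b2]], which expand into brackets with both entries above [a]. *)
Lemma comm_basic n b a : basic lt b -> basic lt a -> wt b + wt a = n ->
  gen (basic_or_gamma n) [~ eval b, eval a].
Proof.
elim/ltn_ind: n b a => n IHn.
pose W := gen (basic_or_gamma n); have sW : subgroup W := gen_sub _.
have gW g : gamma m n.+1 g -> W g by move=> Gg; apply: gen_in; right.
(* The measure of the inner induction: it drops as [a] grows. *)
pose above a := size [seq t <- trees n | `[< lt a t >]].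
have above_lt a u : lt a u -> wt u <= n -> above u < above a.
  move=> au wu; rewrite /above.
  have -> : [seq t <- trees n | `[< lt u t >]] =
      [seq t <- [seq t <- trees n | `[< lt a t >]] | `[< lt u t >]].
    rewrite -filter_predI; apply: eq_filter => t /=.
    by case: (asboolP (lt u t)) => //= ut; apply/esym/asboolP/(lt_trans au).
  rewrite size_filter ltn_neqAle count_size -all_count andbT; apply/allPn; exists u.
    by rewrite mem_filter mem_trees // andbT; apply/asboolP.
  exact/asboolPn/lt_irr.
suff main K a b : above a < K -> basic lt b -> basic lt a -> wt b + wt a = n ->
    lt a b -> W [~ eval b, eval a].
  move=> b a Bb Ba E; case: (lt_total b a) => [->|H|H].
  - by rewrite commgg; apply: sub1.
  - by apply/(subR _ _ sW)/(main (above b).+1) => //; rewrite addnC.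
  - exact: (main (above a).+1).
elim: K a b => // K IHK a b Ka Bb Ba E ab.
have IH u v : basic lt u -> basic lt v -> wt u + wt v = n -> lt a u -> lt a v ->
    W [~ eval u, eval v].
  move=> Bu Bv Euv au av; case: (lt_total u v) => [->|H|H].
  - by rewrite commgg; apply: sub1.
  - apply/(subR _ _ sW)/IHK => //; last by rewrite addnC.
    by apply: leq_trans (above_lt _ _ au _) _ => //; rewrite -Euv leq_addr.
  - apply/IHK => //.
    by apply: leq_trans (above_lt _ _ av _) _ => //; rewrite -Euv leq_addl.
have basicN : match b with Leaf _ => True | Node _ b2 => b2 = a \/ lt b2 a end ->
    W [~ eval b, eval a].
  move=> Hb; apply: gen_in; left; exists (Node b a); split=> //; last by rewrite -commE.
case: b Bb E ab basicN => [i|b1 b2] Bb E ab basicN; first exact: basicN.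
case: (lt_total b2 a) => [H|H|ab2]; [by apply: basicN; left | by apply: basicN; right | ].
case: Bb => B1 B2 b21 _ {basicN}; rewrite /= commE.
have ab1 := lt_trans ab2 b21.
have w1 := wt_gt0 b1; have w2 := wt_gt0 b2; have wa := wt_gt0 a; rewrite /= in E.
(* Here [g] stands for [[v, a]] or its inverse, expanded by the outer induction. Its basic factors
   outweigh [a], hence lie above [a], and the inner induction handles their brackets with [u]. *)
have step u v : basic lt u -> basic lt v -> (wt u + wt v + wt a = n)%N -> lt a u -> lt a v ->
    forall g, gen (basic_or_gamma (wt v + wt a)) g -> W [~ g, eval u].
  move=> Bu Bv Ew au av g Gg.
  have wu := wt_gt0 u; have wv := wt_gt0 v.
  have Ew' : (wt v + wt a + wt u = n)%N by rewrite addnC addnA.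
  apply: (@comm_gen_gamma _ (wt v + wt a) (wt u) W (basic_or_gamma (wt v + wt a)) (eq (eval u))).
  - by rewrite addn_gt0 wv.
  - by [].
  - by [].
  - by rewrite Ew'.
  - by move=> h Hg; apply: basic_or_gamma_sub; apply: gen_in.
  - by move=> g2 <-; apply: gamma_eval.
  - move=> h h2 + <-; case=> [[t [Bt Et ->]]|Gh].
      apply: IH => //; first by rewrite Et.
      by apply: lt_wt; rewrite Et -[X in X < _]add0n ltn_add2r.
    by apply: gW; rewrite -Ew' -addSn; apply: gammaR => //; apply: gamma_eval.
  - exact: Gg.
  - exact: gen_in.
apply: (@Jacobi _ (wt b1) (wt b2) (wt a)); rewrite ?E //; try exact: gamma_eval.
- apply: (step b1 b2) => //; apply: IHn => //.
  by rewrite -E -addnA -[X in X < _]add0n ltn_add2r.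
- have E' : (wt b2 + wt b1 + wt a = n)%N by rewrite (addnC (wt b2)).
  apply: (step b2 b1) => //; rewrite -invgR; apply: gen_inv; apply: IHn => //.
  by rewrite -E' -addnA -[X in X < _]add0n ltn_add2r.
Qed.

Lemma gen_gen_x (g : F m) : gen (fun h => exists i, h = gen_x i) g.
Proof.
pose S (h : F m) := exists i, h = gen_x i.
suff H w : gen S (mkF w).
  by have -> : g = mkF (sval g) by apply: val_inj; rewrite /= reduce_id ?(svalP g).
elim: w => [|[i b] w IH]; first exact: gen_one.
have -> : mkF ((i, b) :: w) = mkF [:: (i, b)] * mkF w.
  by apply: val_inj; rewrite /= (reduce_id (reduce_red w)).
apply: gen_mul => //; case: b.
  have -> : mkF [:: (i, true)] = (gen_x i)^-1 by apply: val_inj.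
  by apply: gen_inv; apply: gen_in; exists i.
by apply: gen_in; exists i.
Qed.

Lemma gamma_gen k g : 0 < k -> gamma m k g -> gen (basic_or_gamma k) g.
Proof.
case: k => // k _; elim: k g => [|k IH] g.
  move=> _; apply: gen_mono (gen_gen_x g) => h [i ->].
  by left; exists (Leaf i).
rewrite gammaS; apply: commsub_min; first exact: gen_sub.
move=> x y /IH Gx _.
apply: (@comm_gen_gamma _ k.+1 1 _ (basic_or_gamma k.+1) (fun h => exists i, h = gen_x i)) => //.
- exact: gen_sub.
- by move=> h; rewrite addn1 => Gh; apply: gen_in; right.
- by move=> h Hh; apply: basic_or_gamma_sub; apply: gen_in.
- move=> u v [[t [Bt Et ->]]|Gu] [i ->].
    by apply: (@comm_basic _ t (Leaf i)) => //=; rewrite Et addn1.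
  by apply: gen_in; right; rewrite gammaS; apply: comm_in.
- exact: gen_gen_x.
Qed.

End Span.

Local Open Scope ring_scope.

(** * Elimination in free associative algebras *)

Definition wtw m (w : seq (tree m)) : nat := \sum_(t <- w) wt t.

Section Independence.
Variables (m : nat) (A : algType rat).
Implicit Types (f : tree m -> A) (S : tree m -> Prop) (w : seq (tree m)).

Definition evalw f w := \prod_(t <- w) f t.

(** Freeness of the subalgebra generated by the [f t], tested only up to weight [N] because the
    algebra used later is truncated there. *)
Definition indep N f S := forall (ws : seq (seq (tree m))) (c : seq (tree m) -> rat),
  uniq ws ->
  (forall w, w \in ws -> (forall t, t \in w -> S t) /\ (wtw w <= N)%N) ->
  \sum_(w <- ws) c w *: evalw f w = 0 -> forall w, w \in ws -> c w = 0.

(** Brings a combination with repeated words into the repetition-free form that [indep] requires. *)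
Lemma sum_collect (V : lmodType rat) (T : choiceType) (f : T -> V) (ps : seq (rat * T)) :
  \sum_(p <- ps) p.1 *: f p.2 =
  \sum_(w <- undup (map snd ps)) (\sum_(p <- ps | p.2 == w) p.1) *: f w.
Proof.
under [RHS]eq_bigr => w _ do rewrite scaler_suml big_mkcond.
rewrite exchange_big /= [LHS]big_seq [RHS]big_seq; apply: eq_bigr => p Hp.
rewrite (bigD1_seq p.2) ?mem_undup ?map_f ?undup_uniq //= eqxx big1 ?addr0 // => w.
by rewrite eq_sym => /negPf->.
Qed.

End Independence.

Section Bracket.
Variables (m : nat) (A : algType rat) (X : 'I_m -> A).
Fixpoint bracket (t : tree m) : A :=
  match t with
  | Leaf i => X i
  | Node b a => bracket b * bracket a - bracket a * bracket b
  end.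
End Bracket.

Section Elimination.
Variables (m N : nat) (A : algType rat) (X : 'I_m -> A).
Let L := bracket X.
Variables (S S' : tree m -> Prop) (a : tree m).
Hypothesis SS' : forall s, S' s -> (S s /\ s <> a) \/ exists2 b, S' b & s = Node b a.
Local Notation V := (seq (tree m) -> rat).
Implicit Types (g : V) (v w : seq (tree m)) (s t b : tree m).

Definition lam s g v : rat := if v is t :: v' then (t == s)%:R * g v' else 0.

(* A representation of the free algebra on [S] in which the letters other than
   [a] act by left multiplication and [a] acts by minus the derivation [b |->
   Node b a]; the bracket [Node b a] then again acts by left multiplication.
   Functions are coefficient functions, so [der] is the transpose on words. *)
Fixpoint der g v : rat :=
  if v is t :: v' then
    der (fun u => g (t :: u)) v' -
    (if t is Node b a' then (a' == a)%:R * g (b :: v') else 0)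
  else 0.

Definition op s : V -> V := if s == a then der else lam s.
Definition act w g := foldr op g w.

Lemma op_sum (I : Type) (r : seq I) (c : I -> rat) (G : I -> V) s v :
  op s (fun u => \sum_(i <- r) c i * G i u) v = \sum_(i <- r) c i * op s (G i) v.
Proof.
rewrite /op; case: (s == a).
  elim: v G => [|t v IH] G /=; first by rewrite big1 // => i _; rewrite mulr0.
  rewrite IH (_ : (match t with Leaf _ => _ | Node _ _ => _ end) =
    \sum_(i <- r) c i * (if t is Node b a' then (a' == a)%:R * G i (b :: v) else 0)).
    by rewrite -sumrB; apply: eq_bigr => i _; rewrite mulrBr.
  case: t => [j|b a'].
    by rewrite big1 // => i _; rewrite mulr0.
  by rewrite mulr_sumr; apply: eq_bigr => i _; rewrite mulrCA.
case: v => [|t v] /=; first by rewrite big1 // => i _; rewrite mulr0.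
by rewrite mulr_sumr; apply: eq_bigr => i _; rewrite mulrCA.
Qed.

Lemma act_sum (I : Type) (r : seq I) (c : I -> rat) (G : I -> V) w v :
  act w (fun u => \sum_(i <- r) c i * G i u) v = \sum_(i <- r) c i * act w (G i) v.
Proof.
elim: w v => //= s w IH v; rewrite -op_sum; congr (op s _ v); exact/funext.
Qed.

(** The Leibniz rule: moving [der] past the letter [b] costs the letter [Node b a]. *)
Lemma lam_der b g v : lam b (der g) v - der (lam b g) v = lam (Node b a) g v.
Proof.
case: v => [|t v] /=; first by rewrite subr0.
have E (c : rat) g0 v0 : der (fun u => c * g0 u) v0 = c * der g0 v0.
  have := op_sum [:: tt] (fun => c) (fun => g0) a v0; rewrite /op eqxx big_seq1 => <-.
  by congr (der _ v0); apply/funext => u; rewrite big_seq1.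
rewrite E opprB addrCA subrr addr0.
case: t => [i|b' a'] /=; first by rewrite mul0r.
rewrite mulrA -natrM mulnb andbC; congr (_%:R * _).
rewrite -!/(_ == _); congr nat_of_bool; apply/andP/eqP => [[/eqP-> /eqP->] //|[-> ->]].
by rewrite !eqxx.
Qed.

(** Relates an element of [A] and an operator that come from the same homogeneous combination of
    words over [S]. This replaces a homomorphism out of the free algebra on [S], which is never
    constructed. *)
Definition represented k (x : A) (r : V -> V) := exists ps : seq (rat * seq (tree m)),
  [/\ (forall p, p \in ps -> (forall t, t \in p.2 -> S t) /\ wtw p.2 = k),
      x = \sum_(p <- ps) p.1 *: evalw L p.2 &
      forall g v, r g v = \sum_(p <- ps) p.1 * act p.2 g v].

Lemma evalw_cat w1 w2 : evalw L (w1 ++ w2) = evalw L w1 * evalw L w2.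
Proof. by rewrite /evalw big_cat. Qed.

Lemma wtw_cat w1 w2 : wtw (w1 ++ w2) = (wtw w1 + wtw w2)%N.
Proof. by rewrite /wtw big_cat. Qed.

Lemma represented1 : represented 0 1 id.
Proof.
exists [:: (1, [::])]; split=> [p|| g v]; rewrite ?big_seq1 ?mul1r //.
  by rewrite inE => /eqP->; split=> //; rewrite /wtw big_nil.
by rewrite /evalw big_nil scale1r.
Qed.

Lemma represented_op s : S s -> represented (wt s) (L s) (op s).
Proof.
move=> Ss; exists [:: (1, [:: s])]; split=> [p|| g v]; rewrite ?big_seq1 ?mul1r //.
  rewrite inE => /eqP->; split=> [t|]; first by rewrite inE => /eqP->.
  by rewrite /wtw big_seq1.
by rewrite /evalw big_seq1 scale1r.
Qed.

Lemma represented_mul i j x y r q : represented i x r -> represented j y q ->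
  represented (i + j) (x * y) (r \o q).
Proof.
move=> [ps [Hps -> Er]] [qs [Hqs -> Eq]].
exists [seq (p.1 * p'.1, p.2 ++ p'.2) | p <- ps, p' <- qs]; split.
- move=> p /allpairsP[[p1 p2] /= [/Hps[H1 E1] /Hqs[H2 E2] ->]] /=; split.
    by move=> t; rewrite mem_cat => /orP[/H1|/H2].
  by rewrite wtw_cat E1 E2.
- rewrite big_allpairs_dep /= mulr_suml; apply: eq_bigr => p _; rewrite mulr_sumr.
  by apply: eq_bigr => p' _; rewrite evalw_cat -scalerAl -scalerAr scalerA.
- move=> g v; rewrite /= Er big_allpairs_dep; apply: eq_bigr => p _.
  have -> : q g = fun u => \sum_(p' <- qs) p'.1 * act p'.2 g u by apply/funext => u; apply: Eq.
  rewrite act_sum mulr_sumr; apply: eq_bigr => p' _.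
  by rewrite mulrA /= /act foldr_cat.
Qed.

Lemma represented_sub k x y r q : represented k x r -> represented k y q ->
  represented k (x - y) (fun g v => r g v - q g v).
Proof.
move=> [ps [Hps -> Er]] [qs [Hqs -> Eq]].
exists (ps ++ [seq (- p.1, p.2) | p <- qs]); split.
- move=> p; rewrite mem_cat => /orP[/Hps //|/mapP[p' /Hqs H ->]]; exact: H.
- by rewrite big_cat big_map -sumrN; congr (_ + _); apply: eq_bigr => p _; rewrite scaleNr.
- move=> g v; rewrite Er Eq big_cat big_map -sumrN; congr (_ + _).
  by apply: eq_bigr => p _; rewrite mulNr.
Qed.

(** An element of [S'] is a letter of [S] other than [a], bracketed zero or more times on the right
    with [a]; on operators [lam_der] absorbs each bracket. *)
Lemma represented_lam s : S a -> S' s -> represented (wt s) (L s) (lam s).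
Proof.
move=> Sa; elim: s => [i|b IHb a' _] /SS'[[Ss /eqP/negPf sa]|[b' Sb' E]] //.
- by have := represented_op Ss; rewrite /op sa.
- by have := represented_op Ss; rewrite /op sa.
case: E Sb' => <- -> /IHb Hb.
have Ha : represented (wt a) (L a) der by have := represented_op Sa; rewrite /op eqxx.
have H1 := represented_mul Hb Ha.
have := represented_mul Ha Hb; rewrite addnC => /(represented_sub H1) /=.
by congr represented; apply/funext => g; apply/funext => v; apply: lam_der.
Qed.

Lemma represented_word w : S a -> (forall t, t \in w -> S' t) ->
  represented (wtw w) (evalw L w) (fun g => foldr lam g w).
Proof.
move=> Sa; elim: w => [|t w IH] Hw.
  by have := represented1; rewrite /wtw /evalw !big_nil.
rewrite /wtw /evalw !big_cons; apply: represented_mul.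
  by apply: represented_lam => //; apply: Hw; rewrite mem_head.
by apply: IH => u Hu; apply: Hw; rewrite inE Hu orbT.
Qed.

Lemma foldr_lam w v : foldr lam (fun u => (u == [::])%:R) w v = (v == w)%:R.
Proof.
elim: w v => [|t w IH] [|u v] //=.
by rewrite IH -natrM mulnb eqseq_cons.
Qed.

(** Expanding brackets turns a relation over [S'] into one over [S]. Its collected coefficients
    vanish, so the operator of the same combination vanishes too; applied to the indicator of the
    empty word, this operator returns the original coefficients. *)
Lemma elimination : S a -> indep N L S -> indep N L S'.
Proof.
move=> Sa indS ws c Uws Hws.
suff [ps [Hps -> Eps]] : exists ps : seq (rat * seq (tree m)),
  [/\ (forall p, p \in ps -> (forall t, t \in p.2 -> S t) /\ (wtw p.2 <= N)%N),
      \sum_(w <- ws) c w *: evalw L w = \sum_(p <- ps) p.1 *: evalw L p.2 &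
      forall g v, \sum_(w <- ws) c w * foldr lam g w v = \sum_(p <- ps) p.1 * act p.2 g v].
  rewrite sum_collect => /indS H w Hw.
  have := Eps (fun u => (u == [::])%:R) w.
  rewrite [RHS](sum_collect (fun u => act u (fun u => (u == [::])%:R) w : rat^o)) => E.
  transitivity (\sum_(w' <- ws) c w' * foldr lam (fun u => (u == [::])%:R) w' w).
    rewrite (bigD1_seq w) //= foldr_lam eqxx mulr1 big1 ?addr0 // => w' ww'.
    by rewrite foldr_lam eq_sym (negPf ww') mulr0.
  rewrite E big_seq big1 // => u Hu; rewrite H ?scale0r ?undup_uniq //.
  by move=> v; rewrite mem_undup => /mapP[p Hp ->]; apply: Hps.
elim: ws Hws {Uws} => [|w ws IH] Hws.
  by exists [::]; split=> // [|g v]; rewrite !big_nil.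
have [|ps [Hps Ex Eps]] := IH; first by move=> u Hu; apply: Hws; rewrite inE Hu orbT.
have [Sw ww] := Hws w (mem_head _ _).
have [qs [Hqs Ey Eqs]] := represented_word Sa Sw.
exists ([seq (c w * p.1, p.2) | p <- qs] ++ ps); split.
- move=> p; rewrite mem_cat => /orP[/mapP[q /Hqs[Sq Eq] ->] /=|/Hps //].
  by rewrite Eq.
- rewrite big_cons big_cat big_map Ex Ey scaler_sumr; congr (_ + _).
  by apply: eq_bigr => p _; rewrite scalerA.
- move=> g v; rewrite big_cons big_cat big_map Eps Eqs mulr_sumr; congr (_ + _).
  by apply: eq_bigr => p _; rewrite mulrA.
Qed.
End Elimination.

Lemma indep_sub m (A : algType rat) N (f : tree m -> A) (S S' : tree m -> Prop) :
  (forall t, S' t -> S t) -> indep N f S -> indep N f S'.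
Proof.
by move=> H iS ws c U Hw; apply: iS => // w /Hw[Hs ?]; split=> // t /Hs/H.
Qed.

(** * Repeated elimination along the order of the basic commutators *)

Section HallSet.
Variables (m N c : nat) (A : algType rat) (X : 'I_m -> A).
Variable lt : tree m -> tree m -> Prop.
Hypothesis Hlt : admissible lt.
Let L := bracket X.

(* The free generators of [gamma_(c+1)] left after eliminating the basic
   commutators of weight at most [c]. *)
Definition hall_basis (t : tree m) :=
  [/\ basic lt t, (c < wt t)%N & if t is Node _ a then (wt a <= c)%N : Prop else True].

Lemma hall_basis_indep : indep N L (fun t => exists i, t = Leaf i) -> indep N L hall_basis.
Proof.
move=> base.
(* The generators left after eliminating the initial segment [p] of [hs]: leaves when [p] is empty,
   and everything in [hall_basis] when [p] is [hs]. *)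
pose S (p : seq (tree m)) t :=
  [/\ basic lt t, t \notin p & if t is Node _ a then a \in p : Prop else True].
pose leb a b := `[< a = b \/ lt a b >].
pose hs := sort leb [seq t <- undup (trees m c) | `[< basic lt t >] && (wt t <= c)%N].
have mem_hs t : (t \in hs) = `[< basic lt t >] && (wt t <= c)%N.
  rewrite mem_sort mem_filter mem_undup; apply: andb_idr => /andP[_].
  exact: mem_trees.
have in_hs t : basic lt t -> (wt t <= c)%N -> t \in hs.
  by move=> Bt wt; rewrite mem_hs wt andbT; apply/asboolP.
have basic_hs t : t \in hs -> basic lt t by rewrite mem_hs => /andP[/asboolP].
have wt_hs t : t \in hs -> (wt t <= c)%N by rewrite mem_hs => /andP[].
have leb_trans : transitive leb.
  move=> b a d /asboolP ab /asboolP bd; apply/asboolP.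
  case: ab => [->//|ab]; case: bd => [<-|bd]; right => //; exact: (lt_trans Hlt) bd.
have leb_total : total leb.
  move=> a b; apply/orP; case: (lt_total Hlt a b) => H; [left|left|right]; apply/asboolP; auto.
have hsU : uniq hs by rewrite sort_uniq filter_uniq ?undup_uniq.
have hsS : pairwise leb hs by rewrite -sorted_pairwise //; apply: sort_sorted.
suff H p q : hs = p ++ q -> indep N L (S p).
  apply: indep_sub (H hs [::] _); last by rewrite cats0.
  move=> t [Bt wt Ht]; split=> //.
    by apply/negP => /wt_hs; rewrite leqNgt wt.
  by case: t Bt Ht {wt} => // b a [_ Ba _ _]; apply: in_hs.
elim/last_ind: p q => [|p a IH] q Ehs.
  apply: indep_sub base => t [_ _]; case: t => // i; by exists i.
rewrite cat_rcons in Ehs.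
have a_hs : a \in hs by rewrite Ehs mem_cat mem_head orbT.
have Ba := basic_hs _ a_hs.
move: hsU hsS; rewrite Ehs cat_uniq pairwise_cat /= => /and3P[_ Hpq /andP[aq _]].
move=> /and3P[/allrelP Lpq _ /andP[/allP Laq _]].
have ap : a \notin p by move: Hpq; rewrite negb_or => /andP[].
have lt_p t : t \in p -> lt t a.
  by move=> tp; have /asboolP[E|//] := Lpq t a tp (mem_head _ _); rewrite -E tp in ap.
have p_lt t : basic lt t -> lt t a -> t \in p.
  move=> Bt ta; have : t \in hs by apply: in_hs => //; apply: leq_trans (wt_lt Hlt ta) (wt_hs _ a_hs).
  rewrite Ehs mem_cat inE; case/or3P => [//|/eqP E|tq]; first by move: ta; rewrite E => /(lt_irr Hlt).
  by have /asboolP[E|/(lt_trans Hlt ta)/(lt_irr Hlt)//] := Laq t tq; rewrite -E in ta; case/(lt_irr Hlt): ta.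
apply: (@elimination _ _ _ _ (S p) _ a) (IH _ Ehs).
(* A new generator is an old one or [[b1, a]]. In the second case the basic condition puts the right
   entry of [b1] at or below [a], so [b1] is itself a new generator. *)
- move=> s [Bs]; rewrite mem_rcons inE negb_or => /andP[/eqP sa sp] Hs.
  case: s Bs sa sp Hs => [i|b1 b2] Bs sa sp Hs; first by left.
  rewrite mem_rcons inE in Hs; case/orP: Hs => [/eqP E|b2p]; last by left.
  right; exists b1; last by rewrite E.
  case: Bs; rewrite E => B1 _ ab1 H1; split=> //.
    rewrite mem_rcons inE negb_or; apply/andP; split.
      by apply/eqP => E1; rewrite E1 in ab1; case/(lt_irr Hlt): ab1.
    by apply/negP => /lt_p/(lt_trans Hlt ab1)/(lt_irr Hlt).
  case: b1 B1 H1 {sa sp ab1} => // b11 b12 [_ B12 _ _] H1.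
  rewrite mem_rcons inE; apply/orP; case: H1 => [->|H1]; [by left|right; exact: p_lt].
(* The right entry of [a] weighs less than [a], so it was eliminated earlier. *)
- split=> //; case: a a_hs Ba p_lt {Ehs Hpq aq Laq ap lt_p Lpq} => // b1 b2 _ [_ B2 _ _] p_lt.
  by apply: p_lt => //; apply: (lt_wt Hlt); rewrite /= -[X in (X < _)%N]add0n ltn_add2r wt_gt0.
Qed.
End HallSet.

(** * The truncated Magnus algebra as a matrix algebra *)

Section Filtration.
Variables (n N : nat) (d : 'I_n.+1 -> nat).
Hypothesis dN : forall p, (d p <= N)%N.
Local Notation A := 'M[rat]_n.+1.
Implicit Types (x y u v : A) (k : nat).

(** With [d] the degree of an index and columns as source, [fil k] holds the matrices raising
    degrees by at least [k], [hom k] those raising them by exactly [k]. *)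
Definition fil k x := forall p q, (d p < d q + k)%N -> x p q = 0.
Definition hom k x := forall p q, d p <> (d q + k)%N -> x p q = 0.

Lemma fil_zero k : fil k 0. Proof. by move=> p q _; rewrite mxE. Qed.
Lemma fil_add k x y : fil k x -> fil k y -> fil k (x + y).
Proof. by move=> Hx Hy p q H; rewrite mxE Hx ?Hy ?addr0. Qed.
Lemma fil_opp k x : fil k x -> fil k (- x).
Proof. by move=> Hx p q H; rewrite mxE Hx ?oppr0. Qed.
Lemma fil_sub k x y : fil k x -> fil k y -> fil k (x - y).
Proof. by move=> Hx Hy; apply/fil_add/fil_opp. Qed.
Lemma fil_scale k (a : rat) x : fil k x -> fil k (a *: x).
Proof. by move=> Hx p q H; rewrite mxE Hx ?mulr0. Qed.
Lemma fil_le i j x : (i <= j)%N -> fil j x -> fil i x.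
Proof. by move=> ij Hx p q H; apply: Hx; apply: leq_trans H _; rewrite leq_add2l. Qed.
Lemma fil_mul i j x y : fil i x -> fil j y -> fil (i + j) (x * y).
Proof.
move=> Hx Hy p q H; rewrite mxE big1 // => r _.
case: (ltnP (d r) (d q + j)) => H1; first by rewrite Hy ?mulr0.
by rewrite Hx ?mul0r //; apply: leq_trans H _; rewrite (addnC i) addnA leq_add2r.
Qed.
Lemma fil_one : fil 0 1.
Proof. by move=> p q; rewrite addn0 mxE; case: eqP => // ->; rewrite ltnn. Qed.
Lemma fil_sum k (I : eqType) (r : seq I) (P : pred I) (G : I -> A) :
  (forall i, i \in r -> P i -> fil k (G i)) -> fil k (\sum_(i <- r | P i) G i).
Proof.
move=> H; rewrite big_seq_cond; elim/big_rec: _ => [|i x /andP[ir Pi] Hx]; first exact: fil_zero.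
by apply: fil_add => //; apply: H.
Qed.
Lemma fil_top x : fil N.+1 x -> x = 0.
Proof.
move=> H; apply/matrixP => p q; rewrite mxE H //.
by apply: leq_ltn_trans (dN p) _; rewrite addnS ltnS leq_addl.
Qed.

Lemma hom_fil k x : hom k x -> fil k x.
Proof. by move=> H p q pq; apply: H => E; rewrite E ltnn in pq. Qed.
Lemma hom_mul i j x y : hom i x -> hom j y -> hom (i + j) (x * y).
Proof.
move=> Hx Hy p q H; rewrite mxE big1 // => r _.
case: (d r =P (d q + j)%N) => H1; last by rewrite Hy ?mulr0.
by rewrite Hx ?mul0r // H1 => E; apply: H; rewrite E -addnA (addnC j).
Qed.
Lemma hom_sub k x y : hom k x -> hom k y -> hom k (x - y).
Proof. by move=> Hx Hy p q H; rewrite !mxE Hx ?Hy ?subrr. Qed.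
Lemma hom_one : hom 0 1.
Proof. by move=> p q; rewrite addn0 mxE; case: eqP => // ->. Qed.
Lemma hom_sum k (I : eqType) (r : seq I) (P : pred I) (a : I -> rat) (G : I -> A) :
  (forall i, i \in r -> P i -> hom k (G i)) -> hom k (\sum_(i <- r | P i) a i *: G i).
Proof.
move=> H; rewrite big_seq_cond; elim/big_rec: _ => [|i x /andP[ir Pi] Hx] p q pq.
  by rewrite mxE.
by rewrite !mxE Hx // (H i) // mulr0 addr0.
Qed.
Lemma hom_fil_zero k x : hom k x -> fil k.+1 x -> x = 0.
Proof.
move=> Hh Hf; apply/matrixP => p q; rewrite mxE.
case: (d p =P (d q + k)%N) => E; last exact: Hh.
by apply: Hf; rewrite E addnS.
Qed.

Lemma fil_exp x k : fil 1 x -> fil k (x ^+ k).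
Proof.
move=> Hx; elim: k => [|k IH]; first exact: fil_one.
by rewrite exprS -add1n; apply: fil_mul.
Qed.

Lemma geometric x : fil 1 x -> (1 + x) * \sum_(i < N.+1) (- x) ^+ i = 1.
Proof.
move=> /fil_opp Hx; have := subrX1 (- x) N.+1.
rewrite (fil_top (@fil_exp _ N.+1 Hx)) sub0r -opprD mulNr addrC => /oppr_inj <-.
by [].
Qed.

Lemma unipotent_unit u : fil 1 (u - 1) -> u \is a GRing.unit.
Proof.
move=> H; have := geometric H; rewrite addrC subrK => E.
by have [] := mulmx1_unit E.
Qed.

Lemma unipotent_inv u : fil 1 (u - 1) -> u^-1 = \sum_(i < N.+1) (1 - u) ^+ i.
Proof.
move=> H; have := geometric H; rewrite addrC subrK opprB => E.
by rewrite -[LHS]mulr1 -[X in _ * X]E mulKr // unipotent_unit.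
Qed.

Lemma fil_unipotent k u : (0 < k)%N -> fil k (u - 1) -> fil 1 (u - 1).
Proof. by move=> k0 H; apply: (fil_le k0 H). Qed.

Lemma fil0_unipotent u : fil 1 (u - 1) -> fil 0 u.
Proof. by move=> H; rewrite -(subrK 1 u); apply: fil_add; [apply: fil_le H|apply: fil_one]. Qed.

Lemma unipotent_mul k u v : fil k (u - 1) -> fil k (v - 1) -> fil k (u * v - 1).
Proof.
move=> Hu Hv; have -> : u * v - 1 = (u - 1) * (v - 1) + (u - 1) + (v - 1).
  by rewrite mulrBl mul1r mulrBr mulr1 addrAC subrK addrA subrK.
apply: fil_add => //; apply: fil_add => //; apply: fil_le (fil_mul Hu Hv); exact: leq_addr.
Qed.

Lemma unipotentV k u : (0 < k)%N -> fil k (u - 1) -> fil k (u^-1 - 1).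
Proof.
move=> k0 Hu; have H1 := fil_unipotent k0 Hu.
have H0 : fil 0 u^-1.
  rewrite (unipotent_inv H1); apply: fil_sum => i _ _.
  by apply: (fil_le (leq0n i)); apply: fil_exp; rewrite -opprB; apply: fil_opp.
have -> : u^-1 - 1 = - (u^-1 * (u - 1)).
  by rewrite mulrBr mulVr ?unipotent_unit // mulr1 opprB.
by apply/fil_opp; rewrite -[k]add0n; apply: fil_mul.
Qed.

End Filtration.

Section Words.
Variable T : eqType.
Fixpoint words (s : seq T) k : seq (seq T) :=
  if k is k'.+1 then [::] :: [seq x :: w | x <- s, w <- words s k'] else [:: [::]].

Lemma mem_words s k w : {subset w <= s} -> (size w <= k)%N -> w \in words s k.
Proof.
elim: k w => [|k IH] [|x w] //= Hw sw; rewrite inE /=.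
apply: allpairs_f; first by apply: Hw; rewrite mem_head.
by apply: IH => // y yw; apply: Hw; rewrite inE yw orbT.
Qed.

Lemma size_words s k w : w \in words s k -> (size w <= k)%N.
Proof.
elim: k w => [|k IH] w /=; first by rewrite inE => /eqP->.
rewrite inE => /orP[/eqP-> //|].
by case/allpairsP => -[x v] [/= _ /IH ? ->].
Qed.
End Words.

Section Magnus.
Variables (m N : nat).
Let ws := undup (words (enum 'I_m) N).
(** The matrix ring wants a dimension in successor form; [ws] contains the empty word, so the
    predecessor loses nothing. *)
Definition magnus_dim := (size ws).-1.
Local Notation A := 'M[rat]_magnus_dim.+1.

Lemma mem_ws w : (w \in ws) = (size w <= N)%N.
Proof.
rewrite mem_undup; apply/idP/idP; first exact: size_words.
by apply: mem_words => i _; rewrite mem_enum.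
Qed.

Lemma size_ws : size ws = magnus_dim.+1.
Proof. by rewrite prednK // lt0n size_eq0; apply/eqP => E; have := mem_ws [::]; rewrite E. Qed.

Definition word_of (p : 'I_magnus_dim.+1) : seq 'I_m := nth [::] ws p.
Definition of_word (w : seq 'I_m) : 'I_magnus_dim.+1 := inord (index w ws).

Lemma of_wordK w : (size w <= N)%N -> word_of (of_word w) = w.
Proof.
by rewrite -mem_ws => H; rewrite /word_of inordK ?nth_index // -size_ws index_mem.
Qed.

Lemma size_word_of p : (size (word_of p) <= N)%N.
Proof. by rewrite -mem_ws mem_nth // size_ws. Qed.

Lemma word_of_inj : injective word_of.
Proof. by move=> p q /eqP; rewrite nth_uniq ?size_ws ?undup_uniq // => /eqP/val_inj. Qed.

(** Left multiplication by the letter [i] on the span of the words of length at most [N], longer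
    products being cut off. *)
Definition mgen (i : 'I_m) : A := \matrix_(p, q) (word_of p == i :: word_of q)%:R.
Local Notation deg := (fun p => size (word_of p)).
Local Notation L := (bracket mgen).

Lemma hom_mgen i : hom deg 1 (mgen i).
Proof. by move=> p q H; rewrite mxE; case: eqP H => // ->; rewrite /= addn1. Qed.

Lemma evalw_leaves w p q : (forall t, t \in w -> exists i, t = Leaf i) ->
  evalw L w p q = (map Leaf (word_of p) == w ++ map Leaf (word_of q))%:R.
Proof.
have Linj : injective (@Leaf m) by move=> i j [].
elim: w p q => [|t w IH] p q Hw.
  by rewrite /evalw big_nil mxE /= (inj_eq (inj_map Linj)) (inj_eq word_of_inj).
have [i Ei] := Hw t (mem_head _ _); rewrite {t}Ei in Hw *.
have {}Hw t : t \in w -> exists i, t = Leaf i by move=> tw; apply: Hw; rewrite inE tw orbT.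
rewrite /evalw big_cons mxE.
transitivity (\sum_r ((word_of p == i :: word_of r)%:R : rat) *
    (map Leaf (word_of r) == w ++ map Leaf (word_of q))%:R).
  by apply: eq_bigr => r _; rewrite -(IH r q Hw) mxE.
case: (altP (_ =P _)) => [E|NE].
  case Ep: (word_of p) E => [|j u] //= [-> Eu].
  have su : (size u <= N)%N by have := size_word_of p; rewrite Ep => /ltnW.
  rewrite (bigD1 (of_word u)) //= of_wordK // eqxx Eu eqxx mulr1 big1 ?addr0 // => r ru.
  rewrite eqseq_cons eqxx /=; case: eqP => [E|_]; last by rewrite mul0r.
  by case/eqP: ru; apply: word_of_inj; rewrite of_wordK.
rewrite big1 // => r _; case: eqP => [E1|_]; last by rewrite mul0r.
by case: eqP => [E2|_]; rewrite ?mulr0 //; case/eqP: NE; rewrite E1 /= E2.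
Qed.

Lemma wtw_leaves w : (forall t : tree m, t \in w -> exists i, t = Leaf i) ->
  exists2 u, w = map Leaf u & size u = wtw w.
Proof.
elim: w => [|t w IH] Hw; first by exists [::]; rewrite // /wtw big_nil.
have [i ->] := Hw t (mem_head _ _).
have [|u -> Eu] := IH; first by move=> s sw; apply: Hw; rewrite inE sw orbT.
exists (i :: u) => //=; rewrite Eu /wtw big_cons /=.
by rewrite add1n.
Qed.

Lemma indep_leaves : indep N L (fun t => exists i, t = Leaf i).
Proof.
move=> vs c Uvs Hvs E w Hw; have [Lw ww] := Hvs w Hw.
have [u Ew su] := wtw_leaves Lw.
(* The column of the empty word shows the coefficients, since a product of letters sends the empty
   word to that product. *)
have := congr1 (fun M : A => M (of_word u) (of_word [::])) E.
rewrite summxE mxE (bigD1_seq w) //= big_seq_cond big1 => [|v /andP[/Hvs[Lv _] vw]].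
  by rewrite addr0 mxE evalw_leaves // !of_wordK ?su // cats0 Ew eqxx mulr1.
rewrite mxE evalw_leaves // !of_wordK ?su // cats0 -Ew eq_sym (negPf vw).
by rewrite mulr0.
Qed.

End Magnus.

(** * The Magnus map *)

Section MagnusMap.
Variables (m N : nat).
Local Notation A := 'M[rat]_((magnus_dim m N).+1).
Local Notation fil := (fil (fun p : 'I_(magnus_dim m N).+1 => size (word_of p))).
Local Notation hom := (hom (fun p : 'I_(magnus_dim m N).+1 => size (word_of p))).
Local Notation L := (bracket (@mgen m N)).
Let dN := @size_word_of m N.
Implicit Types (g h : F m) (t a b : tree m) (w : seq (tree m)).

Definition mletter (l : letter m) : A := if l.2 then (1 + mgen N l.1)^-1 else 1 + mgen N l.1.

Lemma fil_mletter l : fil 1 (mletter l - 1).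
Proof.
have H : fil 1 (1 + mgen N l.1 - 1) by rewrite addrC addKr; apply/hom_fil/hom_mgen.
by rewrite /mletter; case: l.2 => //; apply: (unipotentV dN).
Qed.

Lemma mletter_flip l : mletter l * mletter (flip l) = 1.
Proof.
have H : fil 1 (1 + mgen N l.1 - 1) by rewrite addrC addKr; apply/hom_fil/hom_mgen.
rewrite /mletter /flip /=; case: l.2 => /=; rewrite ?mulVr ?mulrV //; exact: (unipotent_unit dN).
Qed.

Definition magnus g : A := \prod_(l <- sval g) mletter l.
Local Notation mu := magnus.

Lemma magnus_reduce (w : seq (letter m)) : \prod_(l <- reduce w) mletter l = \prod_(l <- w) mletter l.
Proof.
have push l v : \prod_(k <- push l v) mletter k = mletter l * \prod_(k <- v) mletter k.
  case: v => [|k v] /=; first by rewrite big_seq1 big_nil mulr1.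
  case: eqP => [->|_]; last by rewrite !big_cons.
  by rewrite big_cons mulrA mletter_flip mul1r.
by elim: w => //= l w IH; rewrite push IH big_cons.
Qed.

Lemma magnusM g h : mu (g * h)%g = mu g * mu h.
Proof. by rewrite /magnus /= magnus_reduce big_cat. Qed.

Lemma magnus1 : mu 1%g = 1.
Proof. by rewrite /magnus big_nil. Qed.

Lemma fil_magnus g : fil 1 (mu g - 1).
Proof.
rewrite /magnus; elim: (sval g) => [|l w IH]; first by rewrite big_nil subrr; apply: fil_zero.
by rewrite big_cons; apply: unipotent_mul => //; apply: fil_mletter.
Qed.

Lemma magnus_unit g : mu g \is a GRing.unit.
Proof. exact: (unipotent_unit dN (@fil_magnus g)). Qed.

Lemma magnusV g : mu g^-1%g = (mu g)^-1.
Proof. by rewrite -[RHS]mulr1 -magnus1 -(mulgV g) magnusM mulKr ?magnus_unit. Qed.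

(** From [g h = h g [g, h]]: the ring commutator of [mu g - 1] and [mu h - 1] equals
    [mu (g h) - mu (h g)]. *)
Lemma fil_comm_magnus g h :
  mu [~ g, h]%g - 1 = (mu (h * g)%g)^-1 * ((mu g - 1) * (mu h - 1) - (mu h - 1) * (mu g - 1)).
Proof.
have -> : mu [~ g, h]%g = (mu (h * g)%g)^-1 * mu (g * h)%g.
  by rewrite (commgC g h) (magnusM _ [~ g, h]%g) mulKr ?magnus_unit.
rewrite -[X in _ - X](mulVr (magnus_unit (h * g)%g)) -mulrBr; congr (_ * _).
have sub1M (x y : A) : (x - 1) * (y - 1) = x * y - (x + y - 1).
  by rewrite mulrBl mul1r mulrBr mulr1 -addrA -opprD addrA.
rewrite !sub1M (addrC (mu h)) !magnusM; move: (mu g + mu h - 1) => s.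
by rewrite opprB addrA subrK.
Qed.

Lemma fil_gamma k g : (0 < k)%N -> gamma m k g -> fil k (mu g - 1).
Proof.
have sW j : (0 < j)%N -> subgroup (fun g => fil j (mu g - 1)).
  move=> j0; split=> [|x y Hx Hy|x Hx].
  - by rewrite magnus1 subrr; apply: fil_zero.
  - by rewrite magnusM; apply: unipotent_mul.
  - by rewrite magnusV; apply: (unipotentV dN).
case: k => // k _; elim: k g => [|k IH] g; first by move=> _; apply: fil_magnus.
rewrite gammaS; move: g; apply: (commsub_min (sW k.+2 isT)).
move=> x y /IH Hx _; rewrite fil_comm_magnus -[k.+2]add0n; apply: fil_mul.
  by rewrite -magnusV; apply: fil0_unipotent; apply: fil_magnus.
by apply: fil_sub; [rewrite -[k.+2]addn1|rewrite -[k.+2]add1n]; apply: fil_mul => //; apply: fil_magnus.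
Qed.

Lemma magnus_gamma_top g : gamma m N.+1 g -> mu g = 1.
Proof. by move=> /fil_gamma H; apply/eqP; rewrite -subr_eq0; apply/eqP/(fil_top dN)/H. Qed.

Definition magnus_dev t : A := mu (eval t) - 1.
Local Notation U := magnus_dev.

Lemma hom_bracket t : hom (wt t) (L t).
Proof.
elim: t => [i|b IHb a IHa] /=; first exact: hom_mgen.
by apply: hom_sub; [|rewrite addnC]; apply: hom_mul.
Qed.

Lemma fil_U t : fil (wt t) (U t).
Proof. exact: fil_gamma (wt_gt0 t) (gamma_eval t). Qed.

Lemma fil_mul_lead i j (x y x' y' : A) : fil i x -> fil j y' ->
  fil i.+1 (x - x') -> fil j.+1 (y - y') -> fil (i + j).+1 (x * y - x' * y').
Proof.
move=> Hx Hy Hxx Hyy; have -> : x * y - x' * y' = x * (y - y') + (x - x') * y'.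
  by rewrite mulrBr mulrBl addrA subrK.
by apply: fil_add; [rewrite -[(i + j).+1]addnS|rewrite -[(i + j).+1]addSn]; apply: fil_mul.
Qed.

(** By [fil_comm_magnus] the deviation of [[b, a]] is the ring commutator of the deviations of [b]
    and [a], times a factor [V] congruent to 1. *)
Lemma U_lead t : fil (wt t).+1 (U t - L t).
Proof.
elim: t => [i|b IHb a IHa].
  rewrite /magnus_dev /magnus /= big_seq1 /mletter /= [1 + _]addrC addrK subrr; exact: fil_zero.
rewrite /magnus_dev /= commE fil_comm_magnus -/(U b) -/(U a); set V := _^-1; set C := U b * U a - _.
have -> : V * C - (L b * L a - L a * L b) =
    (V - 1) * C + (U b * U a - L b * L a) - (U a * U b - L a * L b).
  have swap (x y z t : A) : (x - y) - (z - t) = (x - z) - (y - t).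
    by rewrite !opprB addrACA [RHS]addrACA (addrC (- y)).
  by rewrite -addrA swap mulrBl mul1r -/C addrA subrK.
have hL t := hom_fil (@hom_bracket t).
apply: fil_sub; last by rewrite addnC; apply: fil_mul_lead => //; apply: fil_U.
apply: fil_add; last by apply: fil_mul_lead => //; apply: fil_U.
rewrite -[(wt b + wt a).+1]add1n; apply: fil_mul; first by rewrite /V -magnusV; apply: fil_magnus.
by apply: fil_sub; [|rewrite addnC]; apply: fil_mul; apply: fil_U.
Qed.

Lemma fil_evalw w : fil (wtw w) (evalw U w).
Proof.
elim: w => [|t w IH]; rewrite /wtw /evalw ?big_nil ?big_cons; first exact: fil_one.
by apply: fil_mul => //; apply: fil_U.
Qed.

Lemma hom_evalw w : hom (wtw w) (evalw L w).
Proof.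
elim: w => [|t w IH]; rewrite /wtw /evalw ?big_nil ?big_cons; first exact: hom_one.
by apply: hom_mul => //; apply: hom_bracket.
Qed.

Lemma evalw_lead w : fil (wtw w).+1 (evalw U w - evalw L w).
Proof.
elim: w => [|t w IH]; rewrite /wtw /evalw ?big_nil ?big_cons.
  by rewrite subrr; apply: fil_zero.
apply: fil_mul_lead => //; [exact: fil_U | exact: hom_fil (@hom_evalw _) | exact: U_lead].
Qed.

(* In a relation among the words, the terms of least weight [k] reduce modulo
   [fil k.+1] to a relation among the brackets. *)
Lemma indep_U (S : tree m -> Prop) : indep N L S -> indep N U S.
Proof.
move=> iL ws c Uws Hws E w Hw.
elim/ltn_ind: {w}(wtw w) {-2}w (erefl (wtw w)) Hw => k IH w Ew Hw.
have := iL ws (fun v => if wtw v == k then c v else 0) Uws Hws.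
have -> : \sum_(v <- ws) (if wtw v == k then c v else 0) *: evalw L v =
    \sum_(v <- ws | wtw v == k) c v *: evalw L v.
  by rewrite [RHS]big_mkcond; apply: eq_bigr => v _; case: eqP => // _; rewrite scale0r.
move/(_ _ w Hw); rewrite Ew eqxx; apply.
apply: (@hom_fil_zero _ (fun p => size (word_of p)) k).
  by apply: hom_sum => v _ /eqP <-; apply: hom_evalw.
have -> : \sum_(v <- ws | wtw v == k) c v *: evalw L v =
    - (\sum_(v <- ws | wtw v == k) c v *: (evalw U v - evalw L v)
       + \sum_(v <- ws | wtw v != k) c v *: evalw U v).
  rewrite -[LHS]opprK; congr (- _); apply/eqP; rewrite eq_sym -subr_eq0 opprK.
  under eq_bigr => v _ do rewrite scalerBr.
  by rewrite sumrB addrAC subrK -(bigID (fun v => wtw v == k) xpredT) /= E.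
apply: fil_opp; apply: fil_add; apply: fil_sum => v vw.
  by move=> /eqP <-; apply: fil_scale; apply: evalw_lead.
move=> nk; case: (ltnP (wtw v) k) => vk.
  by rewrite (IH (wtw v) vk v) // scale0r; apply: fil_zero.
by apply: fil_scale; apply: fil_le (@fil_evalw v); rewrite ltn_neqAle eq_sym nk.
Qed.

(** The words over [S] of weight at most [N] evaluate to a finite free family, and [phi] is the
    coordinate along [w0]. Heavier words evaluate to 0 by truncation, so the formula covers every
    weight. *)
Lemma dual_functional (S : tree m -> Prop) w0 : indep N L S ->
  (forall t, t \in w0 -> S t) -> (wtw w0 <= N)%N ->
  exists phi : {linear A -> rat^o},
    forall w, (forall t, t \in w -> S t) -> phi (evalw U w) = (w == w0)%:R.
Proof.
move=> /indep_U iU Sw0 ww0.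
have wt_mem t w : t \in w -> (wt t <= wtw w)%N.
  by move=> tw; rewrite /wtw (big_rem t) //= leq_addr.
pose W := [seq w <- undup (words (trees m N) N) | `[< forall t, t \in w -> S t >] && (wtw w <= N)%N].
have mem_W w : (forall t, t \in w -> S t) -> (wtw w <= N)%N -> w \in W.
  move=> Sw ww; rewrite mem_filter ww andbT; apply/andP; split; first exact/asboolP.
  rewrite mem_undup; apply: mem_words => [t tw|].
    by apply: mem_trees; apply: leq_trans ww; apply: wt_mem.
  apply: leq_trans ww; rewrite -sum1_size; apply: leq_sum => t _; exact: wt_gt0.
have W_uniq : uniq W by rewrite filter_uniq ?undup_uniq.
pose X := in_tuple (map (evalw U) W).
have sW : size X = size W by rewrite size_map.
have nthX (i : 'I_(size (map (evalw U) W))) : X`_i = evalw U (nth [::] W i).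
  by rewrite (nth_map [::]) // -sW.
have freeX : free X.
  apply/freeP => k E i.
    (* [iU] expects coefficients indexed by words: [k] is extended by 0 to all naturals and read at
       the position of the word in [W]. *)
    pose kk j : rat := oapp k 0 (insub j).
  have kkE (j : 'I_(size (map (evalw U) W))) : kk (val j) = k j by rewrite /kk valK.
  have iW : nth [::] W i \in W by rewrite mem_nth // -sW.
  have := iU W (fun w => kk (index w W)) W_uniq _ _ _ iW.
  rewrite index_uniq ?kkE -?sW //; apply.
    by move=> w; rewrite mem_filter => /andP[/andP[/asboolP]].
  rewrite (big_nth [::]) -sW big_mkord -[RHS]E; apply: eq_bigr => j _.
  by rewrite nthX index_uniq ?kkE -?sW.
have w0W := mem_W _ Sw0 ww0.
have lt0 : (index w0 W < size (map (evalw U) W))%N by rewrite size_map index_mem.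
exists (coord X (Ordinal lt0)) => w Sw; case: (leqP (wtw w) N) => ww.
  have wW := mem_W _ Sw ww.
  have ltw : (index w W < size (map (evalw U) W))%N by rewrite size_map index_mem.
  have -> : evalw U w = X`_(Ordinal ltw) by rewrite nthX nth_index.
  transitivity ((Ordinal ltw == Ordinal lt0)%:R : rat); first exact: coord_free.
  rewrite -val_eqE /=; congr (_%:R); congr nat_of_bool.
  by apply/eqP/eqP => [|-> //]; apply: index_inj.
rewrite (fil_top dN (fil_le ww (@fil_evalw w))) linear0.
by case: eqP => // E; rewrite E ltnNge ww0 in ww.
Qed.

End MagnusMap.

(** * Functions separating the basis *)

Section WordSpan.
Variables (m : nat) (A : algType rat) (f : tree m -> A) (S : tree m -> Prop).

Inductive word_span : A -> Prop :=
| word_span0 : word_span 0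
| word_span_cons (a : rat) w x : (forall t, t \in w -> S t) -> word_span x ->
    word_span (a *: evalw f w + x).

Lemma word_span_word w : (forall t, t \in w -> S t) -> word_span (evalw f w).
Proof. by move=> Sw; have := word_span_cons 1 Sw word_span0; rewrite scale1r addr0. Qed.

Lemma word_span1 : word_span 1.
Proof. by have := @word_span_word [::]; rewrite /evalw big_nil; apply. Qed.

Lemma word_span_gen t : S t -> word_span (f t).
Proof.
move=> St; have := @word_span_word [:: t]; rewrite /evalw big_seq1; apply=> s.
by rewrite inE => /eqP->.
Qed.

Lemma word_spanD x y : word_span x -> word_span y -> word_span (x + y).
Proof.
move=> Bx By; elim: Bx => [|a w z Sw _ IH]; first by rewrite add0r.
by rewrite -addrA; apply: word_span_cons.
Qed.

Lemma word_spanZ a x : word_span x -> word_span (a *: x).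
Proof.
elim=> [|b w z Sw _ IH]; first by rewrite scaler0; apply: word_span0.
by rewrite scalerDr scalerA; apply: word_span_cons.
Qed.

Lemma word_spanM x y : word_span x -> word_span y -> word_span (x * y).
Proof.
move=> Bx By; elim: Bx => [|a w z Sw _ IH]; first by rewrite mul0r; apply: word_span0.
rewrite mulrDl; apply: word_spanD => //; rewrite -scalerAl; apply: word_spanZ.
elim: By => {z IH} [|b v z Sv _ IH]; first by rewrite mulr0; apply: word_span0.
rewrite mulrDr -scalerAr /evalw -big_cat; apply: word_span_cons => // t.
by rewrite mem_cat => /orP[/Sw|/Sv].
Qed.

Lemma word_spanX x k : word_span x -> word_span (x ^+ k).
Proof.
by move=> Bx; elim: k => [|k IH]; [apply: word_span1 | rewrite exprS; apply: word_spanM].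
Qed.

Lemma word_span_sum k (G : 'I_k -> A) : (forall i, word_span (G i)) -> word_span (\sum_i G i).
Proof.
by move=> H; elim/big_rec: _ => [|i x _]; [apply: word_span0 | apply: word_spanD].
Qed.

Definition bilin (F : A -> A -> rat) :=
  (forall a x x' y, F (a *: x + x') y = a * F x y + F x' y) /\
  (forall a x y y', F x (a *: y + y') = a * F x y + F x y').

Lemma bilin_ext F G : bilin F -> bilin G ->
  (forall v w, (forall t, t \in v -> S t) -> (forall t, t \in w -> S t) ->
    F (evalw f v) (evalw f w) = G (evalw f v) (evalw f w)) ->
  forall x y, word_span x -> word_span y -> F x y = G x y.
Proof.
have F0 (H : A -> A -> rat) : bilin H -> (forall y, H 0 y = 0) /\ (forall x, H x 0 = 0).
  case=> H1 H2; split=> z; [have := H1 1 0 0 z | have := H2 1 z 0 0].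
    by rewrite scaler0 addr0 mul1r => /eqP; rewrite -subr_eq0 opprD addrA subrr add0r oppr_eq0 => /eqP.
  by rewrite scaler0 addr0 mul1r => /eqP; rewrite -subr_eq0 opprD addrA subrr add0r oppr_eq0 => /eqP.
move=> bF bG E x y Bx By; have [F0l F0r] := F0 F bF; have [G0l G0r] := F0 G bG.
elim: Bx => [|a w z Sw _ IH]; first by rewrite F0l G0l.
rewrite bF.1 bG.1 IH; congr (_ * _ + _) => {z IH}.
elim: By => [|b v z Sv _ IH]; first by rewrite F0r G0r.
by rewrite bF.2 bG.2 IH E.
Qed.

End WordSpan.

(** [gamma m k] is generated by the basic commutators of weight [k] together with [gamma m k.+1];
    raising [k] step by step ends in [gamma m N.+1]. *)
Lemma gamma_descend m lt (W : F m -> Prop) k N : admissible lt -> (0 < k)%N -> subgroup W ->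
  (forall t, basic lt t -> (k <= wt t)%N -> W (eval t)) ->
  (forall g, gamma m N.+1 g -> W g) -> forall g, gamma m k g -> W g.
Proof.
move=> Hlt k0 sW Wb WN g.
move En: (N.+1 - k)%N => j; elim: j k En k0 Wb g => [|j IH] k En k0 Wb g Gg.
  by apply: WN; apply: gamma_le Gg; rewrite -subn_eq0 En.
have := gamma_gen Hlt k0 Gg; apply: gen_min => // h [[t [Bt Et ->]]|Gh].
  by apply: Wb => //; rewrite Et.
apply: (IH k.+1) => //; first by rewrite subnS En.
by move=> t Bt kt; apply: Wb => //; apply: ltnW.
Qed.

Definition linear_form (A : algType rat) (p : A -> rat) :=
  forall r x y, p (r *: x + y) = r * p x + p y.

Section Separation.
Variables (m n c : nat) (lt : tree m -> tree m -> Prop).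
Hypotheses (Hlt : admissible lt) (nc : (n <= c.+1)%N).
(** Twice the largest weight in [Y], so that the word [b a] survives the truncation. *)
Let N := (c + n + (c + n))%N.
Local Notation A := 'M[rat]_((magnus_dim m N).+1).
Local Notation S := (hall_basis c lt).
Local Notation mu := (@magnus m N).
Local Notation U := (@magnus_dev m N).
Local Notation inB := (word_span U S).
Local Notation H := (gamma m c.+1).
Local Notation K := (gamma m (c + n).+1).
Implicit Types (g h : F m) (s t a b : tree m).

(** A right entry of weight above [c] would force total weight at least [2c + 2], which exceeds
    [c + n]. *)
Lemma Y_hall_basis t : Yset lt c n t -> S t.
Proof.
case: t => [i|b a] [Bt /andP[cw wn]]; split=> //=; last first.
  case: Bt => _ _ /(wt_lt Hlt) ab _; rewrite /= in wn; lia.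
Qed.

Lemma dual w0 : (forall t, t \in w0 -> S t) -> (wtw w0 <= N)%N ->
  exists phi : A -> rat,
    linear_form phi /\
    (forall w, (forall t, t \in w -> S t) -> phi (evalw U w) = (w == w0)%:R).
Proof.
move=> Sw ww; have := @hall_basis_indep m N c _ _ lt Hlt (@indep_leaves m N).
by move=> /dual_functional /(_ Sw ww) [phi Hphi]; exists phi; split=> // r x y; apply: linearP.
Qed.

Lemma separation b a : Yset lt c n b -> Yset lt c n a -> exists q : F m -> rat,
  [/\ (forall g h, commsub H H g -> commsub H H h -> q (g * h)%g = q g + q h),
      (forall g, commsub K H g -> q g = 0) &
      (forall b' a', Yset lt c n b' -> Yset lt c n a' ->
        q [~ eval b', eval a']%g =
          (b' == b)%:R * (a' == a)%:R - (a' == b)%:R * (b' == a)%:R)].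
Proof.
move=> Yb Ya; have Sb := Y_hall_basis Yb; have Sa := Y_hall_basis Ya.
have wN t : Yset lt c n t -> (wtw [:: t] <= N)%N.
  by rewrite /wtw big_seq1 => -[_ /andP[_ H]]; apply: leq_trans H (leq_addr _ _).
have S1 t : S t -> forall s, s \in [:: t] -> S s by move=> St s; rewrite inE => /eqP->.
(* [phi] reads the constant term; below, [phb] and [pha] read the coefficients of the letters [b]
   and [a], and [q] that of the word [b a]. *)
have [phi [lin_phi dphi]] : exists phi : A -> rat,
    linear_form phi /\
    (forall w, (forall t, t \in w -> S t) -> phi (evalw U w) = (w == [::])%:R).
  by apply: dual => //; rewrite /wtw big_nil.
have [phb [lin_phb dphb]] := dual (S1 _ Sb) (wN _ Yb).
have [pha [lin_pha dpha]] := dual (S1 _ Sa) (wN _ Ya).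
have [q [lin_q dq]] : exists q : A -> rat,
    linear_form q /\
    (forall w, (forall t, t \in w -> S t) -> q (evalw U w) = (w == [:: b; a])%:R).
  apply: dual => [t|]; first by rewrite !inE => /orP[] /eqP->.
  rewrite /wtw big_cons big_seq1; apply: leq_add; [case: Yb|case: Ya] => _ /andP[_]; exact.
have phiM x y : inB x -> inB y -> phi (x * y) = phi x * phi y.
  apply: (@bilin_ext _ _ U S (fun x y => phi (x * y)) (fun x y => phi x * phi y)); first split=> *.
  - by rewrite mulrDl -scalerAl lin_phi.
  - by rewrite mulrDr -scalerAr lin_phi.
  - by split=> *; rewrite lin_phi; ring.
  move=> v w Sv Sw; rewrite /evalw -big_cat !dphi //; last by move=> t; rewrite mem_cat => /orP[/Sv|/Sw].
  by case: v {Sv} => //= *; rewrite ?mul1r ?mul0r.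
have single t (p : A -> rat) : linear_form p ->
    (forall w, (forall s, s \in w -> S s) -> p (evalw U w) = (w == [:: t])%:R) ->
    forall x y, inB x -> inB y -> p (x * y) = p x * phi y + phi x * p y.
  move=> lin_p dp; apply: (@bilin_ext _ _ U S (fun x y => p (x * y)) (fun x y => p x * phi y + phi x * p y)); first split=> *.
  - by rewrite mulrDl -scalerAl lin_p.
  - by rewrite mulrDr -scalerAr lin_p.
  - by split=> *; rewrite lin_phi lin_p; ring.
  move=> v w Sv Sw; rewrite /evalw -big_cat !dp ?dphi //; last by move=> s; rewrite mem_cat => /orP[/Sv|/Sw].
  case: v {Sv} => [|u [|u' v]] /=; first by rewrite mul0r mul1r add0r.
    by case: w {Sw} => [|u' w] /=; rewrite ?eqseq_cons ?andbF ?mulr0 ?mulr1 ?mul0r ?addr0.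
  by rewrite !eqseq_cons /= !andbF !mul0r addr0.
(* The three terms are the three places where the word [b a] can be cut. *)
have qM x y : inB x -> inB y -> q (x * y) = q x * phi y + phb x * pha y + phi x * q y.
  apply: (@bilin_ext _ _ U S (fun x y => q (x * y)) (fun x y => q x * phi y + phb x * pha y + phi x * q y)); first split=> *.
  - by rewrite mulrDl -scalerAl lin_q.
  - by rewrite mulrDr -scalerAr lin_q.
  - by split=> *; rewrite ?lin_phi ?lin_phb ?lin_pha lin_q; ring.
  move=> v w Sv Sw; rewrite /evalw -big_cat !dq ?dphi ?dphb ?dpha //; last by move=> s; rewrite mem_cat => /orP[/Sv|/Sw].
  case: v {Sv} => [|u [|u' [|u'' v]]] /=; first by rewrite !mul0r !add0r mul1r.
  - by rewrite !eqseq_cons /= andbF !mul0r add0r addr0 andbT -natrM mulnb.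
  - by rewrite !eqseq_cons /= !andbF andbT !mul0r !addr0 -natrM mulnb -andbA.
  - by rewrite !eqseq_cons /= !andbF !mul0r !addr0.
have linD (p : A -> rat) x y : linear_form p -> p (x + y) = p x + p y.
  by move=> lp; have := lp 1 x y; rewrite scale1r mul1r.
have mu_eval t : mu (eval t) = 1 + U t by rewrite /magnus_dev addrC subrK.
have one : evalw U [::] = 1 by rewrite /evalw big_nil.
have letter t : evalw U [:: t] = U t by rewrite /evalw big_seq1.
(* Constant term 1 turns the product rules for [phb] and [pha] into additivity. *)
pose Gam g := inB (mu g) /\ phi (mu g) = 1.
have phi1 : phi 1 = 1 by rewrite -one dphi.
have GamV g : Gam g -> inB (mu g^-1%g).
  move=> [Bg _]; rewrite magnusV (unipotent_inv (@size_word_of m N) (@fil_magnus m N g)).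
  apply: word_span_sum => i; apply: word_spanX; apply: word_spanD; first exact: word_span1.
  by rewrite -scaleN1r; apply: word_spanZ.
have sGam : subgroup Gam.
  split; first by rewrite /Gam magnus1; split=> //; apply: word_span1.
    by move=> x y [Bx Ex] [By Ey]; rewrite /Gam magnusM phiM ?Ex ?Ey ?mulr1 //; split=> //; apply: word_spanM.
  move=> x Gx; have Bx := GamV _ Gx; case: Gx => B1 E1; split=> //.
  by have := phiM _ _ B1 Bx; rewrite -magnusM mulgV magnus1 phi1 E1 mul1r => <-.
have GamS t : S t -> Gam (eval t).
  move=> St; rewrite /Gam mu_eval; split.
    by apply: word_spanD; [apply: word_span1 | apply: word_span_gen].
  by rewrite linD // phi1 -letter dphi ?addr0 //; apply: S1.
(* Outside [S], a basic commutator of weight above [c] is [[t1, t2]] with [t2], and hence the larger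
   [t1], again of weight above [c]. *)
have GamT t : basic lt t -> (c < wt t)%N -> Gam (eval t).
  elim: t => [i|t1 IH1 t2 IH2] Bt ct; first by apply: GamS; split.
  case: (leqP (wt t2) c) => c2; first by apply: GamS; split.
  case: (Bt) => B1 B2 /(wt_lt Hlt) t21 _; rewrite /= commE.
  have G1 := IH1 B1 (leq_trans c2 t21); have G2 := IH2 B2 c2.
  rewrite commgEl conjgE.
  by apply: (subM sGam); [apply: (subV sGam)|apply: (subM sGam); [apply: (subV sGam)|apply: (subM sGam)]].
have GamH g : H g -> Gam g.
  apply: (gamma_descend Hlt _ sGam GamT (N := N)) => // h /magnus_gamma_top E.
  by rewrite /Gam E; split=> //; apply: word_span1.
have GamR g h : Gam g -> Gam h -> Gam [~ g, h]%g.
  move=> G1 G2; rewrite commgEl conjgE.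
  by apply: (subM sGam); [apply: (subV sGam)|apply: (subM sGam); [apply: (subV sGam)|apply: (subM sGam)]].
have fact (p : A -> rat) t : Yset lt c n t -> linear_form p ->
    (forall w, (forall s, s \in w -> S s) -> p (evalw U w) = (w == [:: t])%:R) ->
    [/\ forall g h, Gam g -> Gam h -> p (mu (g * h)%g) = p (mu g) + p (mu h),
        forall g h, Gam g -> Gam h -> p (mu [~ g, h]%g) = 0,
        forall s, S s -> p (mu (eval s)) = (s == t)%:R &
        forall g, K g -> p (mu g) = 0].
  move=> Yt lin_p dp; have p1 : p 1 = 0 by rewrite -one dp.
  have pM g h : Gam g -> Gam h -> p (mu (g * h)%g) = p (mu g) + p (mu h).
    by move=> [Bg Eg] [Bh Eh]; rewrite magnusM (single t) // Eg Eh mulr1 mul1r.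
  have pR g h : Gam g -> Gam h -> p (mu [~ g, h]%g) = 0.
    move=> Gg Gh; have := pM _ _ (subM sGam Gh Gg) (GamR _ _ Gg Gh).
    by rewrite -commgC (pM _ _ Gg Gh) (pM _ _ Gh Gg) addrC -[LHS]addr0 => /addrI/esym.
  have pS s : S s -> p (mu (eval s)) = (s == t)%:R.
    by move=> Ss; rewrite mu_eval linD // p1 add0r -letter dp ?eqseq_cons ?andbT //; apply: S1.
  split=> // g Kg.
  pose W g := Gam g /\ p (mu g) = 0.
  suff: W g by case.
  have sW : subgroup W.
    split; first by split; [apply: (sub1 sGam)|rewrite magnus1].
      by move=> x y [Gx Ex] [Gy Ey]; split; [apply: (subM sGam)|rewrite pM // Ex Ey addr0].
    move=> x [Gx Ex]; split; first exact: (subV sGam).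
    by have := pM _ _ Gx (subV sGam Gx); rewrite mulgV magnus1 p1 Ex add0r => <-.
  move: g Kg; apply: (gamma_descend Hlt _ sW (N := N)) => // [s Bs ws|g /magnus_gamma_top E].
    have Gs : Gam (eval s) by apply: GamT => //; apply: leq_trans ws; rewrite ltnS leq_addr.
    (* A basic commutator of weight above [c + n] either lies in [S] and differs from [t] by its
       weight, or is a commutator of elements of [Gam], where [pR] applies. *)
    split=> //; case: s Bs ws Gs => [i|s1 s2] Bs ws Gs.
      rewrite pS; last by split=> //; apply: leq_trans ws; rewrite ltnS leq_addr.
      by case: eqP => // E; case: Yt => _ /andP[_]; rewrite -E leqNgt ws.
    case: (leqP (wt s2) c) => c2.
      rewrite pS; last by split=> //; apply: leq_trans ws; rewrite ltnS leq_addr.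
      by case: eqP => // E; case: Yt => _ /andP[_]; rewrite -E leqNgt ws.
    case: (Bs) => B1 B2 /(wt_lt Hlt) t21 _; rewrite /= commE; apply: pR; apply: GamT => //.
    exact: leq_trans t21.
  by split; [rewrite /Gam E; split=> //; apply: word_span1 | rewrite E].
have [bM bR bS bK] := fact _ _ Yb lin_phb dphb.
have [aM aR aS aK] := fact _ _ Ya lin_pha dpha.
have q1 : q 1 = 0 by rewrite -one dq.
have qGM g h : Gam g -> Gam h -> q (mu (g * h)%g) = q (mu g) + q (mu h) + phb (mu g) * pha (mu h).
  by move=> [Bg Eg] [Bh Eh]; rewrite magnusM qM // Eg Eh; ring.
have qR g h : Gam g -> Gam h ->
    q (mu [~ g, h]%g) = phb (mu g) * pha (mu h) - phb (mu h) * pha (mu g).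
  (* Both sides of [g h = h g [g, h]] are expanded by [qGM]; the cross term with [[g, h]] drops
     because [pha] vanishes on it. *)
  move=> Gg Gh; have := qGM _ _ (subM sGam Gh Gg) (GamR _ _ Gg Gh).
  rewrite -commgC (qGM _ _ Gg Gh) (qGM _ _ Gh Gg) aR // mulr0 addr0 => E.
  by apply: (addrI (q (mu h) + q (mu g) + phb (mu h) * pha (mu g))); rewrite -E; ring.
have HHK g : commsub H H g -> [/\ Gam g, phb (mu g) = 0 & pha (mu g) = 0].
  have sW : subgroup (fun g => [/\ Gam g, phb (mu g) = 0 & pha (mu g) = 0]).
    split=> [|x y [Gx bx ax] [Gy b'y ay]|x [Gx bx ax]].
    - by split; [apply: (sub1 sGam)|rewrite magnus1 -one dphb|rewrite magnus1 -one dpha].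
    - by split; [apply: (subM sGam)|rewrite bM // bx b'y addr0|rewrite aM // ax ay addr0].
    - have GV := subV sGam Gx; split=> //.
        by have := bM _ _ Gx GV; rewrite mulgV magnus1 -one dphb //= bx add0r => <-.
      by have := aM _ _ Gx GV; rewrite mulgV magnus1 -one dpha //= ax add0r => <-.
  move: g; apply: (commsub_min sW) => x y /GamH Gx /GamH Gy.
  by split; [apply: GamR|apply: bR|apply: aR].
exists (fun g => q (mu g)); split.
- by move=> g h /HHK[Gg bg _] /HHK[Gh _ _]; rewrite qGM // bg mul0r addr0.
- have KH g : K g -> H g by apply: gamma_le; rewrite ltnS leq_addr.
  pose W g := commsub H H g /\ q (mu g) = 0.
  have sW : subgroup W.
    split; first by split; [apply: gen_one|rewrite magnus1].
      move=> x y [Cx Ex] [Cy Ey]; split; first exact: gen_mul.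
      have [Gx bx _] := HHK _ Cx; have [Gy _ _] := HHK _ Cy.
      by rewrite qGM // Ex Ey bx mul0r !addr0.
    move=> x [Cx Ex]; split; first exact: gen_inv.
    have [Gx bx _] := HHK _ Cx; have := qGM _ _ Gx (subV sGam Gx).
    by rewrite mulgV magnus1 q1 Ex bx mul0r add0r addr0 => <-.
  move=> g Cg; suff: W g by case.
  move: g Cg; apply: (commsub_min sW) => x y Kx Hy; split; first by apply: comm_in => //; apply: KH.
  by rewrite (qR _ _ (GamH _ (KH _ Kx)) (GamH _ Hy)) (bK _ Kx) (aK _ Kx) mul0r mulr0 subr0.
- move=> b' a' Yb' Ya'.
  have [Sb' Sa'] := (Y_hall_basis Yb', Y_hall_basis Ya').
  by rewrite (qR _ _ (GamS _ Sb') (GamS _ Sa')) !bS // !aS.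
Qed.

End Separation.

Local Close Scope ring_scope.

(** * The basis of the multiplier *)

Section IntegerPowers.
Variable m : nat.
Local Open Scope group_scope.
Implicit Types x y : F m.

Lemma fmulE x y : fmul x y = x * y. Proof. by []. Qed.

Lemma finvE x : finv x = x^-1. Proof. by []. Qed.

Lemma iter_fmul k x : iter k (fmul x) (fone m) = x ^+ k.
Proof. by elim: k => //= k ->; rewrite expgS. Qed.

Lemma zpow_succ x (e : int) : zpow x (e + 1)%R = x * zpow x e.
Proof.
case: e => [k|[|k]] //.
- by rewrite -PoszD addn1.
- by change (1 = x * (x * 1)^-1); rewrite mulg1 mulgV.
- have -> : (Negz k.+1 + 1 = Negz k)%R by rewrite !NegzE; lia.
  change ((iter k.+1 (fmul x) (fone m))^-1 = x * (iter k.+2 (fmul x) (fone m))^-1).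
  by rewrite !iter_fmul (expgSr x k.+1) invgM mulVKg.
Qed.

Lemma zpow_sub (W : F m -> Prop) x e : subgroup W -> W x -> W (zpow x e).
Proof.
move=> sW Wx; have H k : W (iter k (fmul x) (fone m)).
  by elim: k => [|k IH]; [apply: (sub1 sW) | apply: (subM sW)].
by case: e => k; [apply: H | apply: (subV sW)].
Qed.

Lemma prodz_sub (W : F m -> Prop) e s : subgroup W ->
  (forall z, z \in s -> W (eval z)) -> W (prodz e s).
Proof.
move=> sW; elim: s => [|z s IH] Hs; first exact: (sub1 sW).
apply: (subM sW); first by apply: zpow_sub => //; apply: Hs; rewrite mem_head.
by apply: IH => t ts; apply: Hs; rewrite inE ts orbT.
Qed.

End IntegerPowers.

(** * Ordered products of powers in an abelian quotient *)

Section Quotient.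
Variables (m : nat) (P D : F m -> Prop).
Local Open Scope group_scope.
Hypotheses (sP : subgroup P) (sD : subgroup D) (nD : normal D).
Hypothesis PD : forall x y, P x -> P y -> D [~ x, y].
Implicit Types x y : F m.

Definition eqmod x y := D (x * y^-1).

Lemma eqmod_refl x : eqmod x x.
Proof. by rewrite /eqmod mulgV; apply: sub1. Qed.

Lemma eqmod_sym x y : eqmod x y -> eqmod y x.
Proof. by move=> /(subV sD); rewrite invgM invgK. Qed.

Lemma eqmod_trans y x z : eqmod x y -> eqmod y z -> eqmod x z.
Proof. by move=> Dx Dy; have := subM sD Dx Dy; rewrite -mulgA mulKg. Qed.

Lemma eqmodMl z x y : eqmod x y -> eqmod (z * x) (z * y).
Proof. by move=> /(@nD _ z^-1); rewrite conjgE invgK /eqmod invgM !mulgA. Qed.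

Lemma eqmodMr z x y : eqmod x y -> eqmod (x * z) (y * z).
Proof. by rewrite /eqmod invgM -mulgA mulVKg. Qed.

Lemma eqmodC x y : P x -> P y -> eqmod (x * y) (y * x).
Proof.
move=> Px Py; have := PD (subV sP Px) (subV sP Py).
by rewrite commgEl conjgE !invgK /eqmod invgM !mulgA.
Qed.

(** Elements of [P] commute modulo [D], so the extra factor [eval z] can be moved to the front. *)
Lemma prodz_incr e s z : (forall t, t \in s -> P (eval t)) -> uniq s -> z \in s ->
  eqmod (prodz (fun t => e t + (t == z)%:R)%R s) (eval z * prodz e s).
Proof.
move=> + + zs; elim: s zs => //= t s IH zs Ps /andP[ts us].
have Pt : P (eval t) by apply: Ps; rewrite mem_head.
have {}Ps u : u \in s -> P (eval u) by move=> us'; apply: Ps; rewrite inE us' orbT.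
move: zs; rewrite inE eq_sym; case: (altP (t =P z)) => [<- _|tz /= zs].
  rewrite fmulE zpow_succ -mulgA.
  have -> : prodz (fun u => e u + (u == t)%:R)%R s = prodz e s; last exact: eqmod_refl.
  elim: s ts {IH us Ps} => //= u s IH; rewrite inE negb_or eq_sym => /andP[/negPf ut ts].
  by rewrite ut addr0 IH.
rewrite addr0; apply: (eqmod_trans (eqmodMl _ (IH zs Ps us))).
rewrite fmulE !mulgA; apply: eqmodMr; apply: eqmodC; last exact: Ps.
exact: zpow_sub.
Qed.

Variables (s : seq (tree m)).
Hypotheses (Ps : forall t, t \in s -> P (eval t)) (us : uniq s).

(* Asking for stability under both [g] and [g^-1] makes this a subgroup at
   once, so that only unit changes of exponents have to be analysed. *)
Definition prodz_stable g :=
  (forall h, (exists e, eqmod h (prodz e s)) -> exists e, eqmod (g * h) (prodz e s)) /\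
  (forall h, (exists e, eqmod h (prodz e s)) -> exists e, eqmod (g^-1 * h) (prodz e s)).

Lemma prodz_stable_sub : subgroup prodz_stable.
Proof.
split=> [|x y [x1 x2] [y1 y2]|x [x1 x2]].
- by split=> h; rewrite ?invg1 mul1g.
- by split=> h; rewrite ?invgM -mulgA => Eh; [apply/x1/y1 | apply/y2/x2].
- by split; rewrite ?invgK.
Qed.

Lemma prodz_stable_in g : prodz_stable g -> exists e, eqmod g (prodz e s).
Proof.
case=> /(_ 1) + _; rewrite mulg1; apply; exists (fun=> 0%R).
have -> : prodz (fun=> 0%R) s = 1 by elim: s => //= t s' ->; rewrite fmulE mulg1.
exact: eqmod_refl.
Qed.

Lemma prodz_stable_D g : D g -> prodz_stable g.
Proof.
have H g' h : D g' -> (exists e, eqmod h (prodz e s)) -> exists e, eqmod (g' * h) (prodz e s).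
  by move=> Dg [e He]; exists e; apply: eqmod_trans He; rewrite /eqmod mulgK.
by move=> Dg; split=> h; apply: H => //; apply: (subV sD).
Qed.

Lemma prodz_stable_mem z : z \in s -> prodz_stable (eval z).
Proof.
move=> zs; split=> h [e He].
  exists (fun t => e t + (t == z)%:R)%R; apply: eqmod_trans (eqmodMl _ He) _.
  by apply: eqmod_sym; apply: prodz_incr.
exists (fun t => e t - (t == z)%:R)%R.
have := prodz_incr (fun t => e t - (t == z)%:R)%R Ps us zs.
have -> : (fun t => e t - (t == z)%:R + (t == z)%:R)%R = e by apply/funext => t; rewrite subrK.
move=> /(eqmod_trans He)/(eqmodMl (eval z)^-1); by rewrite mulKg.
Qed.

End Quotient.

(** * Spanning and independence of [Z] *)

Section MultiplierBasis.
Variables (m n c : nat) (lt : tree m -> tree m -> Prop).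
Hypotheses (Hlt : admissible lt) (nc : n <= c.+1).
Local Notation H := (gamma m c.+1).
Local Notation K := (gamma m (c + n).+1).
Local Notation HH := (commsub H H).
Local Notation KH := (commsub K H).
Local Open Scope group_scope.
Implicit Types (g h : F m) (z t a b : tree m).

Lemma K_H g : K g -> H g.
Proof. by apply: gamma_le; rewrite ltnS leq_addr. Qed.

(** [[H, H]] lies in the term of index [2c + 2], which is at least [c + n + 1] because
    [n <= c + 1]. *)
Lemma HH_K g : HH g -> K g.
Proof.
move: g; apply: commsub_min; first exact: gamma_sub.
move=> x y Hx Hy; apply: gamma_le (gammaR Hx Hy); lia.
Qed.

Lemma KH_normal : normal KH.
Proof. by apply: commsub_normal; apply: gamma_normal. Qed.

Lemma HH_abelian x y : HH x -> HH y -> KH [~ x, y].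
Proof. by move=> /HH_K Kx /HH_K/K_H Hy; apply: comm_in. Qed.

Lemma Y_H t : Yset lt c n t -> H (eval t).
Proof. by move=> [_ /andP[ct _]]; apply: gamma_le ct (gamma_eval t). Qed.

Lemma Z_HH z : Zset lt c n z -> HH (eval z).
Proof. by move=> [b [a [-> [/Y_H Hb [/Y_H Ha _]]]]]; rewrite /= commE; apply: comm_in. Qed.

Definition Y_or_K g := (exists2 t, Yset lt c n t & g = eval t) \/ K g.

Lemma H_gen g : H g -> gen Y_or_K g.
Proof.
apply: (gamma_descend Hlt _ (gen_sub _) (N := (c + n)%N)) => // [t Bt ct|h Kh]; last first.
  by apply: gen_in; right.
apply: gen_in; case: (leqP (wt t) (c + n)) => tn.
  by left; exists t => //; split=> //; rewrite ct.
by right; apply: gamma_le (gamma_eval t).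
Qed.

Lemma Z_span g : HH g -> exists (s : seq (tree m)) (e : tree m -> int),
  [/\ (forall z, z \in s -> Zset lt c n z), uniq s & KH (fmul g (finv (prodz e s)))].
Proof.
(* All of [Z] at once, finite because its weights are at most [2(c + n)]. *)
pose s := [seq z <- undup (trees m (c + n + (c + n))) | `[< Zset lt c n z >]].
have us : uniq s by rewrite filter_uniq ?undup_uniq.
have sZ z : z \in s -> Zset lt c n z by rewrite mem_filter => /andP[/asboolP].
have Zs z : Zset lt c n z -> z \in s.
  move=> Zz; rewrite mem_filter mem_undup; apply/andP; split; first exact/asboolP.
  case: Zz => b [a [-> [[_ /andP[_ wb]] [[_ /andP[_ wa]] _]]]].
  by apply: mem_trees; apply: leq_add.
have sP : subgroup HH := gen_sub _.
have sD : subgroup KH := gen_sub _.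
have Ps t : t \in s -> HH (eval t) by move=> /sZ/Z_HH.
pose W := prodz_stable KH s.
have sW : subgroup W := prodz_stable_sub _ _.
have DW h : KH h -> W h := @prodz_stable_D _ KH sD s h.
have ZW z : Zset lt c n z -> W (eval z).
  by move=> Zz; apply: (prodz_stable_mem sP sD KH_normal HH_abelian) => //; apply: Zs.
suff WHH h : HH h -> W h.
  move=> /WHH /(prodz_stable_in sD) [e He]; by exists s, e.
move: h; apply: (commsub_min sW) => x y /H_gen Gx /H_gen Gy.
have YK h : Y_or_K h -> H h by case=> [[t /Y_H Ht ->] //|/K_H].
have sH : subgroup H := gamma_sub _ _.
(* Triple commutators in [H] lie in [[K, H]], so the commutator is bilinear modulo [W] and only
   generators from [Y] or [K] remain. *)
apply: (comm_gen sH sH sW YK YK) Gx Gy => [u u' v Hu Hu' Hv|u v v' Hu Hv Hv'|u v].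
- by apply/DW/comm_in => //; apply: HH_K; apply: comm_in.
- by apply/DW/comm_in => //; apply: HH_K; apply: comm_in.
case=> [[b Yb ->]|Ku] Yv; last by apply: DW; apply: comm_in => //; apply: YK.
case: Yv => [[a Ya ->]|Kv]; last first.
  by apply/(subR _ _ sW)/DW/comm_in => //; apply: Y_H.
case: (lt_total Hlt b a) => [->|ab|ab].
- by rewrite commgg; apply: sub1.
- apply/(subR _ _ sW); rewrite -commE; apply: (ZW (Node a b)).
  by exists a, b.
- by rewrite -commE; apply: (ZW (Node b a)); exists b, a.
Qed.

Lemma Z_free (s : seq (tree m)) (e : tree m -> int) :
  (forall z, z \in s -> Zset lt c n z) -> uniq s -> KH (prodz e s) ->
  forall z, z \in s -> e z = 0%R.
Proof.
move=> sZ us Ds z zs; have [b [a [Ez [Yb [Ya ab]]]]] := sZ z zs.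
have [q [qM qD qZ]] := separation Hlt nc Yb Ya.
have q1 : q 1 = 0%R by apply: qD; apply: gen_one.
have sP : subgroup HH := gen_sub _.
have qV x : HH x -> q x^-1 = (- q x)%R.
  move=> Hx; have := qM _ _ Hx (subV sP Hx); rewrite mulgV q1 => /esym/eqP.
  by rewrite addrC addr_eq0 => /eqP.
have qX x k : HH x -> q (iter k (fmul x) (fone m)) = (q x *+ k)%R.
  move=> Hx; have Hk j : HH (iter j (fmul x) (fone m)) by apply: (zpow_sub (Posz j) sP Hx).
  by elim: k => [|k IH] /=; rewrite ?q1 ?mulr0n // fmulE qM // IH mulrS.
have qz x k : HH x -> q (zpow x k) = (q x *~ k)%R.
  move=> Hx; case: k => k; first by rewrite /zpow qX.
  by rewrite /zpow finvE qV ?qX //; apply: (zpow_sub (Posz k.+1) sP Hx).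
have qs r : (forall z, z \in r -> Zset lt c n z) ->
    q (prodz e r) = (\sum_(t <- r) q (eval t) *~ e t)%R.
  elim: r => [|t r IH] rZ; first by rewrite big_nil q1.
  have Ht : HH (eval t) by apply/Z_HH/rZ; rewrite mem_head.
  have {}rZ u : u \in r -> Zset lt c n u by move=> ur; apply: rZ; rewrite inE ur orbT.
  rewrite big_cons -IH // -qz // -qM //; first exact: zpow_sub.
  by apply: prodz_sub => // u /rZ/Z_HH.
(* Only the term of [z] survives: on another [[b', a']] the first product of deltas is 0, and the
   second would need [b' = a] and [a' = b], against [a < b] and [a' < b']. *)
have := qs s sZ; rewrite qD // (bigD1_seq z) //= big_seq_cond big1 => [|t /andP[ts tz]].
  rewrite addr0 Ez /= commE qZ // !eqxx mulr1.
  have -> : (a == b) = false by apply/eqP => E; rewrite E in ab; case: (lt_irr Hlt ab).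
  by rewrite mul0r subr0 => /esym/eqP; rewrite intr_eq0 => /eqP.
have [b' [a' [Et [Yb' [Ya' ab']]]]] := sZ t ts.
rewrite Et /= commE qZ //; rewrite Et Ez in tz.
have -> : ((b' == b)%:R * (a' == a)%:R = 0 :> rat)%R.
  case: eqP => [E|_]; last by rewrite mul0r.
  case: eqP => [E'|_]; last by rewrite mulr0.
  by rewrite E E' eqxx in tz.
have -> : ((a' == b)%:R * (b' == a)%:R = 0 :> rat)%R.
  case: eqP => [E|_]; last by rewrite mul0r.
  case: eqP => [E'|_]; last by rewrite mulr0.
  by rewrite E E' in ab'; case: (lt_irr Hlt (lt_trans Hlt ab ab')).
by rewrite subr0 mul0rz.
Qed.

End MultiplierBasis.

Lemma rcomm_gamma m n c : rcomm (gamma m n.+1) c = gamma m (c + n).+1.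
Proof. by elim: c => //= c ->. Qed.

Theorem theorem2p6 (m n c : nat) (hm : (1 <= m)%N) (hn : (1 <= n)%N) (hc : (1 <= c)%N)
  (hcn : (2 * n - 2 < c)%N)
  (lt : tree m -> tree m -> Prop) (Hlt : admissible lt) :
  (* N_{c,1}M(G), G = F/γ_{n+1}(F), equals γ2(γ_{c+1}F)/[γ_{c+n+1}F, γ_{c+1}F] *)
  (forall g, NM_num (gamma m n.+1) c g <-> commsub (gamma m c.+1) (gamma m c.+1) g) /\
  (forall g, NM_den (gamma m n.+1) c g <-> commsub (gamma m (c + n).+1) (gamma m c.+1) g) /\
  (* and it is free abelian with basis Z *)
  free_abelian_basis (commsub (gamma m c.+1) (gamma m c.+1))
                     (commsub (gamma m (c + n).+1) (gamma m c.+1))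
                     (Zset lt c n).
Proof.
(* As [n >= 1], the bound gives [n <= 2n - 1 <= c]. *)
have nc : (n <= c.+1)%N by lia.
split; [move=> g; split=> [[]//|Hg]; split=> // | split; first by rewrite /NM_den rcomm_gamma].
  (* [[H, H]] lies in [gamma m (c + n).+1], hence in [R = gamma m n.+1]. *)
  by apply: (gamma_le _ (HH_K nc Hg)); rewrite ltnS leq_addl.
split.
- by apply: commsub_mono => // x; apply: K_H.
- by move=> g h Hg Hh; rewrite commE; apply: HH_abelian.
- exact: Z_HH.
- exact: Z_span.
- exact: Z_free.
Qed.
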